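(* Consider any execution of the MonadBFT protocol (specified in the context) with $n=3f+1$ validators of which at most $f$ are Byzantine. Suppose a block $B$ contained in a fresh proposal $p$ is speculatively finalized (speculatively committed) by a correct validator, and another block $B'$ is committed by a correct validator such that neither $B$ extends $B'$ nor $B'$ extends $B$. Then the leader of view $p.view$ equivocated.
   Context: MODEL. There are $n=3f+1$ validators; at most $f$ are Byzantine (arbitrary behaviour), the others are correct and follow the protocol. Channels are point-to-point, authenticated and reliable. The network is partially synchronous: there are an unknown time GST and a known $\Delta>0$ such that a message sent at time $\tau$ between correct validators is delivered by $\max(\tau,\mathrm{GST})+\Delta$. ''Broadcast'' means send to all validators (including oneself). Local computation takes no time. Signatures and aggregate signatures are unforgeable; the hash function $H$ is treated as collision-free. An aggregate of $2f+1$ signatures means signatures of $2f+1$ distinct validators. Views are positive integers; each view $v$ has a leader, assigned round-robin. A validator stores all proposals it receives; on obtaining a QC it is assumed also to obtain the proposal the QC points to (and ancestors as needed). $\bot$ denotes an absent field. A correct leader issues at most one proposal per view. DATA. Block $B=\langle block\_view, payload, payload\_hash, qc, block\_hash\rangle$ with $block\_hash=H(block\_view,payload\_hash,qc)$; its header is $B$ without $payload$. Vote $\langle view, block\_hash, proposal\_id,\sigma\rangle$, valid if $proposal\_id=H(block\_hash,view)$ and $\sigma$ is a valid signature on the other fields. QC $\langle view, block\_hash, proposal\_id,\Sigma\rangle$, valid if $proposal\_id=H(block\_hash,view)$ and $\Sigma$ aggregates $2f+1$ signatures on the other fields; it points to any proposal with the same $proposal\_id$. Proposal $p=\langle view, proposal\_id,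 block,\sigma,tc,nec\rangle$ with $proposal\_id=H(block.block\_hash,view)$, $\sigma$ the leader's signature on $proposal\_id$ ($tc,nec$ possibly $\bot$). The tip of $p$ is $p$ with its block replaced by the block header. Timeout message $M=\langle view, tip, tip\_vote, qc, last\_cer,\sigma\rangle$. Timeout certificate (TC) $\langle view, tips\_views, high\_tip, qcs\_views, high\_qc,\Sigma\rangle$, where $tips\_views,qcs\_views$ give for each of $2f+1$ contributing validators the view of the reported tip ($\bot$, counted as $0$ in maxima, if it reported a QC) and the view of the reported QC (of the QC in the tip's header if it reported a tip). No-endorsement certificate (NEC) $\langle view, high\_tip\_qc\_view,\Sigma\rangle$. There are a genesis block and a genesis tip and genesis QC of view $0$, valid without signatures; initially they are $local\_tip$ and $last\_qc$. VALIDITY. A header is valid if its $qc$ is valid and its $block\_hash$ is correct; a block is valid if additionally $payload\_hash=H(payload)$. fresh($p$): $p.block.qc.view=p.view-1$, or $p.nec\ne\bot$, or ($p.tc\neq\bot$ and $p.tc.high\_qc\ne\bot$). Valid fresh tip $T$: valid header, correct $proposal\_id$, $\sigma$ by the leader of $T.view$, $header.block\_view=T.view>header.qc.view$, and: if $T.view=header.qc.view+1$ then $T.tc=T.nec=\bot$; otherwise $T.tc\neq\bot$ is valid with $T.view=T.tc.view+1$, and either ($T.nec=\bot$, $T.tc.high\_qc\ne\bot$ and $header.qc=T.tc.high\_qc$) or ($T.nec$ is valid, $T.view=T.nec.view$ and $header.qc.view=T.nec.high\_tip\_qc\_view$). Valid proposal $p$: valid block, correct $proposal\_id$, $\sigma$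 by the leader of $p.view$, $p.view\ge p.block.block\_view$, $p.view>p.block.qc.view$, and: if fresh($p$), the tip of $p$ is a valid fresh tip; otherwise (''reproposal'') $p.view>p.block.block\_view$, $p.tc\neq\bot$ is valid, $p.view=p.tc.view+1$, $p.tc.high\_tip\ne\bot$, and the header of $p.block$ equals $p.tc.high\_tip$'s header. (So a valid proposal is fresh iff $p.view=p.block.block\_view$.) Valid timeout message $M$: $last\_cer$ is a valid QC or TC with $last\_cer.view=M.view-1$; exactly one of $tip,qc$ is non-$\bot$; if $tip\neq\bot$: $tip\_vote$ is a valid vote with $tip\_vote.view=M.view$, $tip$ is a valid fresh tip with $tip.view\le M.view$, $\sigma$ signs $(M.view,tip.view,tip.header.qc.view)$; if $qc\ne\bot$: $qc$ is valid, $qc.view<M.view$, $\sigma$ signs $(M.view,\bot,qc.view)$. Valid TC $tc$: $\Sigma$ aggregates $2f+1$ timeout signatures certifying $view,tips\_views,qcs\_views$; and either ($high\_qc\ne\bot$ is valid, $high\_tip=\bot$, $high\_qc.view<tc.view$, $\max(tips\_views)\le high\_qc.view=\max(qcs\_views)$) or ($high\_qc=\bot$, $high\_tip$ is a valid fresh tip, $high\_tip.view\le tc.view$, $qcs\_views[i]<tips\_views[i]$ whenever $tips\_views[i]\ne\bot$, no $tips\_views[i]>high\_tip.view$, no $i$ with $tips\_views[i]=high\_tip.view$ and $qcs\_views[i]>high\_tip.header.qc.view$, and $high\_tip.view>\max(qcs\_views)$). Valid NEC: $high\_tip\_qc\_view<view-1$ and $\Sigma$ aggregates $2f+1$ signatures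 on $(view,high\_tip\_qc\_view)$. LOCAL STATE of validator $i$: $cur\_view$, $local\_tip$, $highest\_voted\_view$, $last\_qc$, $last\_tc$, collected votes and timeouts, and a timer. At start every validator performs Enter(genesis QC), entering view $1$, and the leader of view 1 performs ProposeQC(genesis QC). PROCEDURES. Enter($c$) ($c$ a QC or TC): if $c.view\ge cur\_view$, set $cur\_view:=c.view+1$, restart the timer, and set $last\_qc:=c$ (QC) or $last\_tc:=c$ (TC). Commit($qc$): let $parent$ be the proposal $qc$ points to and $gp$ the proposal $parent.block.qc$ points to; if fresh($parent$), speculatively commit $parent.block$; if $qc.view=parent.block.qc.view+1$, commit $gp.block$ (and all its ancestors). ProposeQC($qc$): broadcast a proposal for $cur\_view$ with a new block $B$, $B.block\_view=cur\_view$, $B.qc=qc$, and $tc=nec=\bot$. ProposeTC($tc$): if $tc.high\_qc\neq\bot$, broadcast a proposal for $cur\_view$ with a new block with $qc=tc.high\_qc$, this $tc$, $nec=\bot$; else if the block of $tc.high\_tip$ is available, broadcast a proposal for $cur\_view$ containing that same block, this $tc$, $nec=\bot$; else run Recover($tc$): if it returns a proposal, repropose its block as before; if it returns an NEC, broadcast a proposal with a new block with $qc=tc.high\_tip.header.qc$, this $tc$, and this $nec$. Recover($tc$): broadcast $\langle\mathsf{NERequest},tc\rangle$, send $\langle\mathsf{ProposalRequest},tc\rangle$ to $\kappa$ validators and, every $\Theta_{interval}$ time, to $\kappa$ further ones; return the first received proposal with $proposal\_id=tc.high\_tip.proposal\_id$, or an NEC with view $tc.view+1$ and $high\_tip\_qc\_view=tc.high\_tip.header.qc.view$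 once $2f+1$ validators sent valid NE signatures on this pair; abort if Recover is called for a higher view. BroadcastQC($qc$): broadcast $qc$ if not yet done. HANDLERS (messages of a view smaller than indicated, or invalid, are ignored). (1) On a valid proposal $p$ from the leader of $p.view\ge cur\_view$: Enter($p.tc$) if $p.tc\ne\bot$, else Enter($p.block.qc$); if $p.block.qc.view=p.view-1$, then BroadcastQC($p.block.qc$) if $i$ is the leader of view $p.block.qc.view$, and send $p.block.qc$ to that leader; Commit($p.block.qc$); if $p.view>highest\_voted\_view$: set $local\_tip$ to the tip of $p$ if fresh($p$) and to $p.tc.high\_tip$ otherwise, send a vote for ($cur\_view$, block hash of $local\_tip$) to the leaders of views $cur\_view$ and $cur\_view+1$, and set $highest\_voted\_view:=cur\_view$. (2) On a valid vote with view $v\ge cur\_view$, if $i$ leads $v$ or $v+1$: once $2f+1$ votes with the same $proposal\_id$ are collected, form the QC $qc$; Enter($qc$); Commit($qc$); BroadcastQC($qc$) if $i$ leads $v$, else ProposeQC($qc$). (3) On a valid QC $qc$ from $j$ with $qc.view\ge cur\_view$: if $j$ leads $qc.view$: Enter($qc$), Commit($qc$), send $qc$ to the leader of $qc.view+1$; if $i$ leads $qc.view$: BroadcastQC($qc$); if $i$ leads $qc.view+1$: Enter($qc$), Commit($qc$), ProposeQC($qc$). (4) On timing out in $cur\_view=v$ (at most once per view; when the timer reaches $\Theta_{view}$ or when triggered in (5)): $highest\_voted\_view:=v$; broadcast a timeout message for view $v$ with $last\_cer=last\_qc$ if $last\_qc.view=v-1$ and $last\_cer=last\_tc$ otherwise;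 if $local\_tip.view\le last\_qc.view$ it has $qc=last\_qc$, $tip=tip\_vote=\bot$; otherwise $tip=local\_tip$, $tip\_vote$ a vote for ($v$, block hash of $local\_tip$), $qc=\bot$. (5) On a valid timeout message $M$ with $M.view\ge cur\_view$: let $c=M.last\_cer$; if $c$ is a TC and $i$ has broadcast neither a timeout message nor a TC for $c.view$, broadcast $c$; Enter($c$); if $i$ leads $c.view+1$ and has issued no proposal for it, ProposeQC($c$) or ProposeTC($c$) according to the type of $c$; if $c$ is a QC: BroadcastQC($c$) if $i$ leads $c.view$, send $c$ to the leaders of $c.view$ and $c.view+1$, Commit($c$). Then: if $M.tip\neq\bot$, record $M.tip\_vote$; if $2f+1$ tip votes with the same $proposal\_id$ are recorded, form the QC $qc$, Enter($qc$), Commit($qc$), ProposeQC($qc$) if $i$ leads $qc.view+1$, and stop. Otherwise record $M$; when $f+1$ timeout messages for $M.view$ are recorded, trigger the timeout of view $M.view$ if not yet triggered; when $2f+1$ are recorded, form a TC $tc$ (with $high\_tip$ the reported tip of highest view, ties broken by highest $header.qc.view$, if this view exceeds all reported QC views; otherwise with $high\_qc$ the highest reported QC), Enter($tc$), and ProposeTC($tc$) if $i$ leads $tc.view+1$. (6) On a valid TC $tc$ with $tc.view\ge cur\_view$: Enter($tc$); broadcast $tc$ if no TC and no timeout message was broadcast for $tc.view$; ProposeTC($tc$) if $i$ leads $tc.view+1$. (7) On $\langle\mathsf{ProposalRequest},tc\rangle$ or $\langle\mathsf{NERequest},tc\rangle$ from the leader of $tc.view+1\ge cur\_view$, with $tc$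 valid and $tc.high\_tip\neq\bot$: Enter($tc$); for a ProposalRequest, if $i$ has a proposal with $proposal\_id=tc.high\_tip.proposal\_id$, send it to that leader; for an NERequest, if $i$ has not voted for a proposal with that $proposal\_id$ and has sent no NE message in view $tc.view+1$, send that leader an NE signature on $(tc.view+1,tc.high\_tip.header.qc.view)$. TERMINOLOGY. Block $B_1$ is the parent of $B_2$ if some proposal $p$ has $p.block=B_1$ and $p.proposal\_id=B_2.qc.proposal\_id$. Block $B_2$ extends $B_1$ if $B_2=B_1$ or $B_2$ is a descendant of $B_1$ under the parent relation. Committing a block commits all its ancestors. A proposal is fresh if it contains a new block ($p.view=p.block.block\_view$). ''The block $B$ contained in the fresh proposal $p$ is speculatively finalized'' means that a correct validator speculatively commits $B=p.block$ in procedure Commit($qc$) for a QC $qc$ pointing to $p$. A leader equivocates in a view if it issues more than one distinct proposal in that view. *)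

(* Defs.v *)
(* Membership is [List.In] in sequences over types that carry no decidable
   equality. *)
From HB Require Import structures.
From Stdlib Require List Relations.
From mathcomp Require Import all_boot all_order all_algebra.
Set Implicit Arguments.
Unset Strict Implicit.
Unset Printing Implicit Defensive.
Import Order.TTheory GRing.Theory Num.Theory.

Declare Scope cmd_scope.

Section MonadBFT.

(* [R] is the time domain. *)
Context (R : realFieldType) (f : nat) (hash payload : Type).

Definition validator := 'I_(3 * f).+1.

Definition leader (v : nat) : validator := inord (v %% (3 * f).+1).

(* Signatures are symbolic: a pair of the signer and of the signed content.
   Unforgeability is a constraint on executions, see [authentic]. *)
Inductive content :=
| CVote (view : nat) (block_hash proposal_id : hash)
| CProposal (proposal_id : hash)
| CTimeout (view : nat) (tip_view : option nat) (qc_view : nat)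
| CNoEndorsement (view high_tip_qc_view : nat).

Record signature := Sig { signer : validator; signed : content }.

Record vote := Vote {
  vote_view : nat; vote_hash : hash; vote_pid : hash; vote_sig : signature }.

Record qc := QC {
  qc_view : nat; qc_hash : hash; qc_pid : hash; qc_sigs : seq signature }.

Record header := Header {
  block_view : nat; payload_hash : hash; hqc : qc; block_hash : hash }.

Record block := Block { bheader :> header; bpayload : payload }.

Record nec := NEC {
  nec_view : nat; nec_qc_view : nat; nec_sigs : seq signature }.

(* Absent fields are [None].  The signature of a tip or proposal is absent only
   for genesis. [tips_views], [qcs_views] and [sigs] of a TC are aligned. *)
Inductive tip :=
| Tip (view : nat) (pid : hash) (hd : header) (sg : option signature)
      (otc : option tc) (onec : option nec)
with tc :=
| TC (view : nat) (tips_views : seq (option nat)) (high_tip : option tip)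
     (qcs_views : seq nat) (high_qc : option qc) (sigs : seq signature).

Definition tip_view (T : tip) := let: Tip v _ _ _ _ _ := T in v.
Definition tip_pid (T : tip) := let: Tip _ pid _ _ _ _ := T in pid.
Definition tip_header (T : tip) := let: Tip _ _ hd _ _ _ := T in hd.
Definition tip_sig (T : tip) := let: Tip _ _ _ sg _ _ := T in sg.
Definition tip_tc (T : tip) := let: Tip _ _ _ _ otc _ := T in otc.
Definition tip_nec (T : tip) := let: Tip _ _ _ _ _ onec := T in onec.
Definition tip_qc (T : tip) := hqc (tip_header T).

Definition tc_view (c : tc) := let: TC v _ _ _ _ _ := c in v.
Definition tips_views (c : tc) := let: TC _ tv _ _ _ _ := c in tv.
Definition high_tip (c : tc) := let: TC _ _ ht _ _ _ := c in ht.
Definition qcs_views (c : tc) := let: TC _ _ _ qv _ _ := c in qv.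
Definition high_qc (c : tc) := let: TC _ _ _ _ hq _ := c in hq.
Definition tc_sigs (c : tc) := let: TC _ _ _ _ _ sg := c in sg.

Record proposal := Proposal {
  prop_view : nat; prop_pid : hash; prop_block : block;
  prop_sig : option signature; prop_tc : option tc; prop_nec : option nec }.

Definition tip_of (p : proposal) : tip :=
  Tip (prop_view p) (prop_pid p) (bheader (prop_block p)) (prop_sig p)
      (prop_tc p) (prop_nec p).

Definition prop_qc (p : proposal) : qc := hqc (prop_block p).

Inductive cert := CertQC (q : qc) | CertTC (c : tc).

Definition cert_view (c : cert) : nat :=
  match c with CertQC q => qc_view q | CertTC t => tc_view t end.

Record timeout := Timeout {
  tmo_view : nat; tmo_tip : option tip; tmo_tip_vote : option vote;
  tmo_qc : option qc; tmo_last_cer : cert; tmo_sig : signature }.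

Inductive msg :=
| MProposal (p : proposal)
| MVote (vt : vote)
| MQC (q : qc)
| MTimeout (M : timeout)
| MTC (c : tc)
| MProposalRequest (c : tc)
| MNERequest (c : tc)
| MNE (sg : signature).

(* One hash function on a tagged union, so that injectivity also separates its
   three uses. *)
Inductive hash_input :=
| OfPayload (x : payload)
| OfHeader (view : nat) (payload_hash : hash) (q : qc)
| OfProposal (block_hash : hash) (view : nat).

(* The [hqc] field of the genesis block is an unsigned placeholder of view 0
   that points to no proposal. *)
Record setting := Setting {
  byz : {set validator};
  byz_le : #|byz| <= f;
  hash_fun : hash_input -> hash;
  hash_inj : injective hash_fun;
  genesis_block : block;
  genesis_view : block_view genesis_block = 0;
  genesis_payload_hash :
    payload_hash genesis_block = hash_fun (OfPayload (bpayload genesis_block));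
  genesis_block_hash :
    block_hash genesis_block =
      hash_fun (OfHeader 0 (payload_hash genesis_block) (hqc genesis_block));
  genesis_hqc :
    qc_view (hqc genesis_block) = 0 /\ qc_sigs (hqc genesis_block) = [::];
  genesis_no_parent :
    forall h v, qc_pid (hqc genesis_block) <> hash_fun (OfProposal h v);
  delta : R;
  delta_gt0 : (0 < delta)%R;
  theta_view : R;
  theta_interval : R;
  kappa : nat }.

Context (S : setting).
Local Notation H := (hash_fun S).

Definition correct (i : validator) : Prop := i \notin byz S.

Definition genesis_pid : hash := H (OfProposal (block_hash (genesis_block S)) 0).
Definition genesis_qc : qc :=
  QC 0 (block_hash (genesis_block S)) genesis_pid [::].
Definition genesis_tip : tip :=
  Tip 0 genesis_pid (bheader (genesis_block S)) None None None.

Definition aggregate (sigs : seq signature) : Prop :=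
  size sigs = (2 * f).+1 /\ uniq [seq signer s | s <- sigs].

Definition signed_qc (q : qc) : Prop :=
  [/\ qc_pid q = H (OfProposal (qc_hash q) (qc_view q)),
      aggregate (qc_sigs q)
    & forall s, List.In s (qc_sigs q) ->
        signed s = CVote (qc_view q) (qc_hash q) (qc_pid q)].

Definition valid_qc (q : qc) : Prop := q = genesis_qc \/ signed_qc q.

Definition valid_vote (vt : vote) : Prop :=
  vote_pid vt = H (OfProposal (vote_hash vt) (vote_view vt)) /\
  signed (vote_sig vt) = CVote (vote_view vt) (vote_hash vt) (vote_pid vt).

Definition correct_block_hash (h : header) : Prop :=
  block_hash h = H (OfHeader (block_view h) (payload_hash h) (hqc h)).

Definition correct_payload_hash (b : block) : Prop :=
  payload_hash b = H (OfPayload (bpayload b)).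

Definition valid_header (h : header) : Prop :=
  h = bheader (genesis_block S) \/ (valid_qc (hqc h) /\ correct_block_hash h).

Definition valid_block (b : block) : Prop :=
  valid_header b /\ correct_payload_hash b.

Definition valid_nec (e : nec) : Prop :=
  [/\ (nec_qc_view e).+1 < nec_view e, aggregate (nec_sigs e)
    & forall s, List.In s (nec_sigs e) ->
        signed s = CNoEndorsement (nec_view e) (nec_qc_view e)].

Definition max_tips (tv : seq (option nat)) : nat := \max_(x <- tv) odflt 0 x.
Definition max_qcs (qv : seq nat) : nat := \max_(x <- qv) x.

Fixpoint valid_fresh_tip (T : tip) : Prop :=
  let: Tip v pid hd sg otc onec := T in
  T = genesis_tip \/
  [/\ valid_header hd,
      pid = H (OfProposal (block_hash hd) v),
      sg = Some (Sig (leader v) (CProposal pid)),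
      block_view hd = v /\ qc_view (hqc hd) < v
    & if v == (qc_view (hqc hd)).+1 then otc = None /\ onec = None
      else match otc with
           | None => False
           | Some c =>
             [/\ valid_tc c, v = (tc_view c).+1
               & match onec with
                 | None => high_qc c = Some (hqc hd)
                 | Some e => [/\ valid_nec e, v = nec_view e
                               & qc_view (hqc hd) = nec_qc_view e]
                 end]
           end]
with valid_tc (c : tc) : Prop :=
  let: TC v tv ht qv hq sg := c in
  [/\ aggregate sg, size tv = (2 * f).+1, size qv = (2 * f).+1,
      [seq signed s | s <- sg] = [seq CTimeout v x.1 x.2 | x <- zip tv qv]
    & match hq, ht with
      | Some q, None =>
        [/\ valid_qc q, qc_view q < v, max_tips tv <= qc_view q
          & qc_view q = max_qcs qv]
      | None, Some T =>
        [/\ valid_fresh_tip T, tip_view T <= v,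
            forall i t, i < size tv -> nth None tv i = Some t ->
              [/\ nth 0 qv i < t, t <= tip_view T
                & t = tip_view T -> nth 0 qv i <= qc_view (tip_qc T)]
          & max_qcs qv < tip_view T]
      | _, _ => False
      end].

Definition fresh (p : proposal) : Prop :=
  [\/ (qc_view (prop_qc p)).+1 = prop_view p,
      prop_nec p <> None
    | exists c q, prop_tc p = Some c /\ high_qc c = Some q].

(* The constraints on hashes that belong to the very notions of block and
   proposal; the signature is left out as genesis has none. *)
Definition well_formed (p : proposal) : Prop :=
  [/\ prop_pid p = H (OfProposal (block_hash (prop_block p)) (prop_view p)),
      correct_block_hash (prop_block p) & correct_payload_hash (prop_block p)].

Definition valid_proposal (p : proposal) : Prop :=
  [/\ valid_block (prop_block p),
      prop_pid p = H (OfProposal (block_hash (prop_block p)) (prop_view p)),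
      prop_sig p = Some (Sig (leader (prop_view p)) (CProposal (prop_pid p))),
      block_view (prop_block p) <= prop_view p /\
        qc_view (prop_qc p) < prop_view p
    & (fresh p -> valid_fresh_tip (tip_of p)) /\
      (~ fresh p ->
        block_view (prop_block p) < prop_view p /\
        exists c T, [/\ prop_tc p = Some c, valid_tc c,
          prop_view p = (tc_view c).+1, high_tip c = Some T
          & bheader (prop_block p) = tip_header T])].

Definition valid_cert (c : cert) : Prop :=
  match c with CertQC q => valid_qc q | CertTC t => valid_tc t end.

Definition valid_timeout (M : timeout) : Prop :=
  let v := tmo_view M in
  [/\ valid_cert (tmo_last_cer M), (cert_view (tmo_last_cer M)).+1 = v
    & match tmo_tip M, tmo_qc M with
      | Some T, None =>
        [/\ exists vt, [/\ tmo_tip_vote M = Some vt, valid_vote vt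
                         & vote_view vt = v],
            valid_fresh_tip T, tip_view T <= v
          & signed (tmo_sig M) =
              CTimeout v (Some (tip_view T)) (qc_view (tip_qc T))]
      | None, Some q =>
        [/\ valid_qc q, qc_view q < v
          & signed (tmo_sig M) = CTimeout v None (qc_view q)]
      | _, _ => False
      end].

Definition points_to (q : qc) (p : proposal) : Prop :=
  well_formed p /\ prop_pid p = qc_pid q.

(* A QC formed from tip votes may certify a tip in a view in which nobody
   issued a reproposal of it; [p] therefore ranges over all well-formed
   proposals, sent or not.  Collision-freeness makes the parent unique. *)
Definition parent (B1 B2 : block) : Prop :=
  exists p, points_to (hqc B2) p /\ prop_block p = B1.

Definition extends (B2 B1 : block) : Prop :=
  Relation_Operators.clos_refl_trans block parent B1 B2.

Inductive note :=
| GotVote (vt : vote)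
| GotTipVote (vt : vote)
| GotTimeout (M : timeout)
| GotNE (sg : signature)
| Stored (p : proposal)
| Voted (pid : hash)
| TimedOut (view : nat)
| SentTC (view : nat)
| SentQC (q : qc)
| SentNE (view : nat)
| Proposed (view : nat)
| SpecCommitted (p : proposal)
| Committed (b : block).

Record recovery := Recovery {
  rec_tc : tc; rec_asked : {set validator}; rec_next : R }.

(* [timer] is the time of the last restart. *)
Record state := State {
  cur_view : nat; timer : R; local_tip : tip; highest_voted_view : nat;
  last_qc : qc; last_tc : option tc; recoveries : seq recovery;
  log : seq note }.

Definition logged (n : note) (s : state) : Prop := List.In n (log s).

Definition set_local_tip (T : tip) (s : state) : state :=
  State (cur_view s) (timer s) T (highest_voted_view s) (last_qc s) (last_tc s)
        (recoveries s) (log s).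
Definition set_highest_voted (v : nat) (s : state) : state :=
  State (cur_view s) (timer s) (local_tip s) v (last_qc s) (last_tc s)
        (recoveries s) (log s).
Definition set_recoveries (rs : seq recovery) (s : state) : state :=
  State (cur_view s) (timer s) (local_tip s) (highest_voted_view s) (last_qc s)
        (last_tc s) rs (log s).
Definition add_note (n : note) (s : state) : state :=
  State (cur_view s) (timer s) (local_tip s) (highest_voted_view s) (last_qc s)
        (last_tc s) (recoveries s) (n :: log s).
Definition set_view (now : R) (c : cert) (s : state) : state :=
  State (cert_view c).+1 now (local_tip s) (highest_voted_view s)
        (if c is CertQC q then q else last_qc s)
        (if c is CertTC t then Some t else last_tc s)
        (recoveries s) (log s).

Definition init_state : state :=
  State 0 0%R genesis_tip 0 genesis_qc None [::] [::].

(* Relations between an initial state, a final state and the addressed messages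
   sent in between. *)
Definition cmd := state -> state -> seq (validator * msg) -> Prop.

Definition skip : cmd := fun s s' o => s' = s /\ o = [::].
Definition update (g : state -> state) : cmd :=
  fun s s' o => s' = g s /\ o = [::].
Definition send (m : msg) (j : validator) : cmd :=
  fun s s' o => s' = s /\ o = [:: (j, m)].
Definition send_to (K : {set validator}) (m : msg) : cmd :=
  fun s s' o => s' = s /\ o = [seq (j, m) | j <- enum K].
Definition broadcast (m : msg) : cmd := send_to [set: validator] m.
Definition andthen (c1 c2 : cmd) : cmd := fun s s' o =>
  exists s1 o1 o2, [/\ c1 s s1 o1, c2 s1 s' o2 & o = o1 ++ o2].
Definition ifelse (P : state -> Prop) (c1 c2 : cmd) : cmd := fun s s' o =>
  (P s /\ c1 s s' o) \/ (~ P s /\ c2 s s' o).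
Definition choosing (A : Type) (Q : state -> A -> Prop) (k : A -> cmd) : cmd :=
  fun s s' o => exists x, Q s x /\ k x s s' o.
Definition ifsome (A : Type) (Q : state -> A -> Prop) (k : A -> cmd)
    (c : cmd) : cmd :=
  ifelse (fun s => exists x, Q s x) (choosing Q k) c.
Definition when (P : state -> Prop) (c : cmd) : cmd := ifelse P c skip.
Definition reading (k : state -> cmd) : cmd := fun s s' o => k s s s' o.
Definition remember (n : note) : cmd := update (add_note n).

Notation "c1 ;; c2" := (andthen c1 c2)
  (at level 90, right associativity) : cmd_scope.
Local Open Scope cmd_scope.

Section Handlers.

(* The validator executing the code, the current time, and the proposals sent
   so far in the execution. *)
Context (self : validator) (now : R) (sent : proposal -> Prop).

Definition leads (v : nat) : Prop := leader v = self.

Definition Enter (c : cert) : cmd :=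
  when (fun s => cur_view s <= cert_view c) (update (set_view now c)).

Definition obtainable (q : qc) (p : proposal) : Prop :=
  [/\ sent p, valid_proposal p & prop_pid p = qc_pid q].

(* If nobody sent a proposal that [q] points to, then [q] is the genesis QC or
   was formed from tip votes on a tip of an earlier view; neither commit rule
   applies to such a [q]. The grandparent, by contrast, may be such a
   proposal, and is only required to be one that [prop_qc par] points to. *)
Definition Commit (q : qc) : cmd :=
  ifsome (fun _ => obtainable q)
    (fun par =>
      remember (Stored par) ;;
      when (fun _ => fresh par) (remember (SpecCommitted par)) ;;
      when (fun _ => qc_view q = (qc_view (prop_qc par)).+1)
        (choosing (fun _ => points_to (prop_qc par)) (fun gp =>
          when (fun _ => obtainable (prop_qc par) gp) (remember (Stored gp)) ;;
          remember (Committed (prop_block gp)))))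
    skip.

(* A correct leader issues at most one proposal per view. *)
Definition issue (v : nat) (b : block) (otc : option tc) (onec : option nec)
    : cmd :=
  let pid := H (OfProposal (block_hash b) v) in
  when (fun s => ~ logged (Proposed v) s)
    (remember (Proposed v) ;;
     broadcast (MProposal (Proposal v pid b
       (Some (Sig self (CProposal pid))) otc onec))).

Definition new_block (v : nat) (q : qc) (x : payload) : block :=
  let ph := H (OfPayload x) in
  Block (Header v ph q (H (OfHeader v ph q))) x.

Definition issue_new (v : nat) (q : qc) (otc : option tc) (onec : option nec)
    : cmd :=
  choosing (fun _ _ => True) (fun x => issue v (new_block v q x) otc onec).

Definition ProposeQC (q : qc) : cmd :=
  reading (fun s => issue_new (cur_view s) q None None).

Definition ask_more (c : tc) (asked : {set validator})
    (k : {set validator} -> cmd) : cmd :=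
  choosing (fun _ (K : {set validator}) =>
      [disjoint K & asked] /\ #|K| = minn (kappa S) #|~: asked|)
    (fun K => send_to K (MProposalRequest c) ;; k (asked :|: K)).

Definition Recover (c : tc) : cmd :=
  broadcast (MNERequest c) ;;
  ask_more c set0 (fun asked => update (fun s => set_recoveries
    (Recovery c asked (now + theta_interval S)%R ::
       [seq r <- recoveries s | tc_view c <= tc_view (rec_tc r)]) s)).

(* The Recover call returned: [tc_view c].+1 is the view of the leader's
   ProposeTC call. *)
Definition finish_recovery (c : tc) : cmd :=
  update (fun s => set_recoveries
    [seq r <- recoveries s | tc_view (rec_tc r) != tc_view c] s).

Definition ProposeTC (c : tc) : cmd :=
  match high_qc c, high_tip c with
  | Some q, _ => reading (fun s => issue_new (cur_view s) q (Some c) None)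
  | None, Some T =>
    ifsome (fun s p => logged (Stored p) s /\
                       bheader (prop_block p) = tip_header T)
      (fun p => reading (fun s =>
         issue (cur_view s) (prop_block p) (Some c) None))
      (Recover c)
  | None, None => skip
  end.

Definition Propose (c : cert) : cmd :=
  match c with CertQC q => ProposeQC q | CertTC t => ProposeTC t end.

Definition BroadcastQC (q : qc) : cmd :=
  when (fun s => ~ logged (SentQC q) s)
    (remember (SentQC q) ;; broadcast (MQC q)).

Definition BroadcastTC (c : tc) : cmd :=
  when (fun s => ~ logged (SentTC (tc_view c)) s /\
                 ~ logged (TimedOut (tc_view c)) s)
    (remember (SentTC (tc_view c)) ;; broadcast (MTC c)).

Definition make_vote (v : nat) (h : hash) : vote :=
  let pid := H (OfProposal h v) in Vote v h pid (Sig self (CVote v h pid)).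

Definition forms_qc (note_of : vote -> note) (vt : vote) (s : state) (q : qc)
    : Prop :=
  [/\ qc_view q = vote_view vt, qc_hash q = vote_hash vt,
      qc_pid q = vote_pid vt, aggregate (qc_sigs q)
    & forall sg, List.In sg (qc_sigs q) ->
        exists vt', [/\ logged (note_of vt') s, vote_pid vt' = vote_pid vt
                      & vote_sig vt' = sg]].

Definition recorded_timeouts (v k : nat) (s : state) (Ms : seq timeout)
    : Prop :=
  [/\ size Ms = k, uniq [seq signer (tmo_sig M) | M <- Ms]
    & forall M, List.In M Ms -> logged (GotTimeout M) s /\ tmo_view M = v].

Definition reported_qc (M : timeout) : qc :=
  match tmo_tip M, tmo_qc M with
  | Some T, _ => tip_qc T
  | None, Some q => q
  | None, None => genesis_qc
  end.

Definition reports_tip (Ms : seq timeout) (T : tip) : Prop :=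
  exists M, List.In M Ms /\ tmo_tip M = Some T.

Definition forms_tc (v : nat) (s : state) (c : tc) : Prop :=
  exists Ms, recorded_timeouts v (2 * f).+1 s Ms /\
  let tv := [seq omap tip_view (tmo_tip M) | M <- Ms] in
  let qv := [seq qc_view (reported_qc M) | M <- Ms] in
  let sg := [seq tmo_sig M | M <- Ms] in
  if max_qcs qv < max_tips tv then
    exists T, [/\ c = TC v tv (Some T) qv None sg, reports_tip Ms T,
      tip_view T = max_tips tv
      & forall T', reports_tip Ms T' -> tip_view T' = tip_view T ->
          qc_view (tip_qc T') <= qc_view (tip_qc T)]
  else
    exists M, [/\ List.In M Ms, qc_view (reported_qc M) = max_qcs qv
      & c = TC v tv None qv (Some (reported_qc M)) sg].

Definition forms_nec (v qv : nat) (s : state) (e : nec) : Prop :=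
  [/\ nec_view e = v, nec_qc_view e = qv, aggregate (nec_sigs e)
    & forall sg, List.In sg (nec_sigs e) ->
        logged (GotNE sg) s /\ signed sg = CNoEndorsement v qv].

Definition voting_tip (p : proposal) (T : tip) : Prop :=
  (fresh p /\ T = tip_of p) \/
  (~ fresh p /\ exists c, prop_tc p = Some c /\ high_tip c = Some T).

Definition on_leader_proposal (p : proposal) : cmd :=
  Enter (if prop_tc p is Some c then CertTC c else CertQC (prop_qc p)) ;;
  when (fun _ => (qc_view (prop_qc p)).+1 = prop_view p)
    (when (fun _ => leads (qc_view (prop_qc p))) (BroadcastQC (prop_qc p)) ;;
     send (MQC (prop_qc p)) (leader (qc_view (prop_qc p)))) ;;
  Commit (prop_qc p) ;;
  when (fun s => highest_voted_view s < prop_view p)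
    (choosing (fun _ => voting_tip p) (fun T => reading (fun s =>
       let v := cur_view s in
       let vt := make_vote v (block_hash (tip_header T)) in
       update (set_local_tip T) ;;
       send (MVote vt) (leader v) ;;
       send (MVote vt) (leader v.+1) ;;
       remember (Voted (vote_pid vt)) ;;
       update (set_highest_voted v)))).

(* Any valid proposal received is stored and may answer a pending Recover;
   only one that comes from its leader and is not outdated is voted on. *)
Definition on_proposal (j : validator) (p : proposal) : cmd :=
  when (fun _ => valid_proposal p)
    (remember (Stored p) ;;
     when (fun s => j = leader (prop_view p) /\ cur_view s <= prop_view p)
       (on_leader_proposal p) ;;
     ifsome (fun s r => List.In r (recoveries s) /\
               exists T, high_tip (rec_tc r) = Some T /\
                         prop_pid p = tip_pid T)
       (fun r =>
         finish_recovery (rec_tc r) ;;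
         issue (tc_view (rec_tc r)).+1 (prop_block p) (Some (rec_tc r)) None)
       skip).

Definition on_vote (vt : vote) : cmd :=
  let v := vote_view vt in
  when (fun s => [/\ valid_vote vt, cur_view s <= v & leads v \/ leads v.+1])
    (remember (GotVote vt) ;;
     ifsome (forms_qc GotVote vt)
       (fun q =>
         Enter (CertQC q) ;;
         Commit q ;;
         ifelse (fun _ => leads v) (BroadcastQC q) (ProposeQC q))
       skip).

Definition on_qc (j : validator) (q : qc) : cmd :=
  let v := qc_view q in
  when (fun s => valid_qc q /\ cur_view s <= v)
    (when (fun _ => leader v = j)
       (Enter (CertQC q) ;; Commit q ;; send (MQC q) (leader v.+1)) ;;
     when (fun _ => leads v) (BroadcastQC q) ;;
     when (fun _ => leads v.+1)
       (Enter (CertQC q) ;; Commit q ;; ProposeQC q)).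

Definition last_certificate (s : state) (c : cert) : Prop :=
  if (qc_view (last_qc s)).+1 == cur_view s then c = CertQC (last_qc s)
  else exists t, last_tc s = Some t /\ c = CertTC t.

Definition do_timeout : cmd :=
  when (fun s => ~ logged (TimedOut (cur_view s)) s)
    (choosing last_certificate (fun c => reading (fun s =>
      let v := cur_view s in
      let T := local_tip s in
      let q := last_qc s in
      update (set_highest_voted v) ;;
      remember (TimedOut v) ;;
      broadcast (MTimeout
        (if tip_view T <= qc_view q then
           Timeout v None None (Some q) c
             (Sig self (CTimeout v None (qc_view q)))
         else
           Timeout v (Some T) (Some (make_vote v (block_hash (tip_header T))))
             None c
             (Sig self (CTimeout v (Some (tip_view T))
                                   (qc_view (tip_qc T))))))))).

Definition record_timeout (M : timeout) : cmd :=
  let v := tmo_view M in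
  remember (GotTimeout M) ;;
  when (fun s => (exists Ms, recorded_timeouts v f.+1 s Ms) /\
                 ~ logged (TimedOut v) s)
    do_timeout ;;
  ifsome (forms_tc v)
    (fun c => Enter (CertTC c) ;;
              when (fun _ => leads (tc_view c).+1) (ProposeTC c))
    skip.

Definition on_timeout (M : timeout) : cmd :=
  let c := tmo_last_cer M in
  when (fun s => valid_timeout M /\ cur_view s <= tmo_view M)
    ((if c is CertTC t then BroadcastTC t else skip) ;;
     Enter c ;;
     when (fun s => leads (cert_view c).+1 /\
                    ~ logged (Proposed (cert_view c).+1) s)
       (Propose c) ;;
     (if c is CertQC q then
        when (fun _ => leads (qc_view q)) (BroadcastQC q) ;;
        send (MQC q) (leader (qc_view q)) ;;
        send (MQC q) (leader (qc_view q).+1) ;;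
        Commit q
      else skip) ;;
     match tmo_tip M, tmo_tip_vote M with
     | Some _, Some vt =>
       remember (GotTipVote vt) ;;
       ifsome (forms_qc GotTipVote vt)
         (fun q =>
           Enter (CertQC q) ;;
           Commit q ;;
           when (fun _ => leads (qc_view q).+1) (ProposeQC q))
         (record_timeout M)
     | _, _ => record_timeout M
     end).

Definition on_tc (c : tc) : cmd :=
  when (fun s => valid_tc c /\ cur_view s <= tc_view c)
    (Enter (CertTC c) ;;
     BroadcastTC c ;;
     when (fun _ => leads (tc_view c).+1) (ProposeTC c)).

Definition on_request (j : validator) (c : tc) (answer : tip -> cmd) : cmd :=
  ifsome (fun s T =>
      [/\ j = leader (tc_view c).+1, cur_view s <= (tc_view c).+1, valid_tc c
        & high_tip c = Some T])
    (fun T => Enter (CertTC c) ;; answer T)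
    skip.

Definition on_proposal_request (j : validator) (c : tc) : cmd :=
  on_request j c (fun T =>
    ifsome (fun s p => logged (Stored p) s /\ prop_pid p = tip_pid T)
      (fun p => send (MProposal p) j)
      skip).

Definition on_ne_request (j : validator) (c : tc) : cmd :=
  let v := (tc_view c).+1 in
  on_request j c (fun T =>
    when (fun s => ~ logged (Voted (tip_pid T)) s /\ ~ logged (SentNE v) s)
      (remember (SentNE v) ;;
       send (MNE (Sig self (CNoEndorsement v (qc_view (tip_qc T))))) j)).

Definition on_ne (sg : signature) : cmd :=
  ifsome (fun s (rT : recovery * tip) =>
      [/\ List.In rT.1 (recoveries s), high_tip (rec_tc rT.1) = Some rT.2
        & signed sg = CNoEndorsement (tc_view (rec_tc rT.1)).+1
                                     (qc_view (tip_qc rT.2))])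
    (fun rT =>
      let c := rec_tc rT.1 in
      let v := (tc_view c).+1 in
      remember (GotNE sg) ;;
      ifsome (forms_nec v (qc_view (tip_qc rT.2)))
        (fun e => finish_recovery c ;;
                  issue_new v (tip_qc rT.2) (Some c) (Some e))
        skip)
    skip.

Definition handle (j : validator) (m : msg) : cmd :=
  match m with
  | MProposal p => on_proposal j p
  | MVote vt => on_vote vt
  | MQC q => on_qc j q
  | MTimeout M => on_timeout M
  | MTC c => on_tc c
  | MProposalRequest c => on_proposal_request j c
  | MNERequest c => on_ne_request j c
  | MNE sg => on_ne sg
  end.

Definition start : cmd :=
  Enter (CertQC genesis_qc) ;; when (fun _ => leads 1) (ProposeQC genesis_qc).

Definition timer_expires : cmd := fun s s' o =>
  (timer s + theta_view S <= now)%R /\ do_timeout s s' o.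

Definition recover_again : cmd := fun s s' o =>
  exists rs1 r rs2,
    [/\ recoveries s = rs1 ++ r :: rs2, (rec_next r <= now)%R
      & ask_more (rec_tc r) (rec_asked r) (fun asked =>
          update (set_recoveries (rs1 ++
            Recovery (rec_tc r) asked (now + theta_interval S)%R :: rs2)))
          s s' o].

End Handlers.

Fixpoint sigs_of_tip (T : tip) : seq signature :=
  let: Tip _ _ hd sg otc onec := T in
  qc_sigs (hqc hd) ++ (if sg is Some s then [:: s] else [::]) ++
  (if otc is Some c then sigs_of_tc c else [::]) ++
  (if onec is Some e then nec_sigs e else [::])
with sigs_of_tc (c : tc) : seq signature :=
  let: TC _ _ ht _ hq sg := c in
  (if ht is Some T then sigs_of_tip T else [::]) ++
  (if hq is Some q then qc_sigs q else [::]) ++ sg.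

Definition sigs_of_cert (c : cert) : seq signature :=
  match c with CertQC q => qc_sigs q | CertTC t => sigs_of_tc t end.

Definition sigs_of_timeout (M : timeout) : seq signature :=
  (if tmo_tip M is Some T then sigs_of_tip T else [::]) ++
  (if tmo_tip_vote M is Some vt then [:: vote_sig vt] else [::]) ++
  (if tmo_qc M is Some q then qc_sigs q else [::]) ++
  sigs_of_cert (tmo_last_cer M) ++ [:: tmo_sig M].

Definition sigs_of (m : msg) : seq signature :=
  match m with
  | MProposal p => sigs_of_tip (tip_of p)
  | MVote vt => [:: vote_sig vt]
  | MQC q => qc_sigs q
  | MTimeout M => sigs_of_timeout M
  | MTC c | MProposalRequest c | MNERequest c => sigs_of_tc c
  | MNE sg => [:: sg]
  end.

(* Includes the tips nested in TCs; a proposal counts as its tip. *)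
Fixpoint tips_of_tip (T : tip) : seq tip :=
  let: Tip _ _ _ _ otc _ := T in
  T :: (if otc is Some c then tips_of_tc c else [::])
with tips_of_tc (c : tc) : seq tip :=
  let: TC _ _ ht _ _ _ := c in
  if ht is Some T then tips_of_tip T else [::].

Definition tips_of (m : msg) : seq tip :=
  match m with
  | MProposal p => tips_of_tip (tip_of p)
  | MTimeout M =>
      (if tmo_tip M is Some T then tips_of_tip T else [::]) ++
      (if tmo_last_cer M is CertTC c then tips_of_tc c else [::])
  | MTC c | MProposalRequest c | MNERequest c => tips_of_tc c
  | MVote _ | MQC _ | MNE _ => [::]
  end.

Record envelope := Envelope {
  src : validator; dst : validator; body : msg; sent_at : R }.

(* [net]: messages in transit; [hist]: all messages sent so far.  The local
   states of Byzantine validators are meaningless. *)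
Record config := Config {
  now : R; local : validator -> state; net : seq envelope;
  hist : seq envelope }.

Definition envelopes (t : R) (i : validator) (o : seq (validator * msg))
    : seq envelope :=
  [seq Envelope i x.1 x.2 t | x <- o].

Definition sent (c : config) (p : proposal) : Prop :=
  exists e, List.In e (hist c) /\ body e = MProposal p.

(* Unforgeability: the signatures of correct validators in [m] were made, and
   sent, by these validators.  Byzantine validators may share their keys. *)
Definition authentic (c : config) (m : msg) : Prop :=
  forall sg, List.In sg (sigs_of m) -> correct (signer sg) ->
    exists e, [/\ List.In e (hist c), src e = signer sg
                & List.In sg (sigs_of (body e))].

Definition executes (i : validator) (a : cmd) (net0 : seq envelope)
    (c c' : config) : Prop :=
  exists s' o, a (local c i) s' o /\
    let es := envelopes (now c) i o in
    c' = Config (now c) (fun j => if j == i then s' else local c j)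
                (net0 ++ es) (hist c ++ es).

(* Byzantine recipients need no delivery event: the adversary may use
   everything in [hist]. *)
Inductive step (c c' : config) : Prop :=
| StepTime (d : R) :
    (0 <= d)%R ->
    c' = Config (now c + d)%R (local c) (net c) (hist c) -> step c c'
| StepDeliver (es1 es2 : seq envelope) (e : envelope) :
    net c = es1 ++ e :: es2 -> correct (dst e) ->
    executes (dst e) (handle (dst e) (now c) (sent c) (src e) (body e))
             (es1 ++ es2) c c' ->
    step c c'
| StepTimer (i : validator) :
    correct i ->
    executes i (timer_expires i (now c)) (net c) c c' -> step c c'
| StepRecover (i : validator) :
    correct i -> executes i (recover_again (now c)) (net c) c c' -> step c c'
| StepByzantine (i j : validator) (m : msg) :
    ~ correct i -> authentic c m ->
    c' = Config (now c) (local c) (rcons (net c) (Envelope i j m (now c)))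
                (rcons (hist c) (Envelope i j m (now c))) ->
    step c c'.

Definition initial (c : config) : Prop :=
  now c = 0%R /\
  exists outs : validator -> seq (validator * msg),
    [/\ forall i, correct i -> start i 0%R init_state (local c i) (outs i),
        forall i, ~ correct i -> outs i = [::],
        net c = flatten [seq envelopes 0%R i (outs i) | i <- enum 'I_(3 * f).+1]
      & hist c = net c].

(* No deadline has been missed: message delivery (partial synchrony), timers of
   the current view, and the periodic requests of Recover. *)
Definition timely (GST : R) (c : config) : Prop :=
  [/\ forall e, List.In e (net c) -> correct (src e) -> correct (dst e) ->
        (now c <= Num.max (sent_at e) GST + delta S)%R,
      forall i, correct i ->
        ~ logged (TimedOut (cur_view (local c i))) (local c i) ->
        (now c <= timer (local c i) + theta_view S)%R
    & forall i r, correct i -> List.In r (recoveries (local c i)) ->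
        (now c <= rec_next r)%R].

(* Steps of duration 0 without effect are allowed, so that finite executions
   are covered as well. *)
Record execution (GST : R) (C : nat -> config) : Prop := Execution {
  exec_initial : initial (C 0);
  exec_step : forall k, step (C k) (C k.+1);
  exec_timely : forall k, timely GST (C k) }.

Definition fresh_proposal (p : proposal) : Prop :=
  prop_view p = block_view (prop_block p).

Definition speculatively_finalized (C : nat -> config) (p : proposal) (B : block)
    : Prop :=
  exists i k, [/\ correct i, logged (SpecCommitted p) (local (C k) i)
                & prop_block p = B].

(* The log records the blocks passed to "commit"; these are committed together
   with all their ancestors. *)
Definition committed (C : nat -> config) (B : block) : Prop :=
  exists i k G, [/\ correct i, logged (Committed G) (local (C k) i)
                  & extends G B].

(* A proposal is issued when it appears signed by its leader, in full or as a
   tip (a Byzantine leader may reveal a proposal through its tip only). *)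
Definition issued (C : nat -> config) (T : tip) : Prop :=
  [/\ tip_pid T = H (OfProposal (block_hash (tip_header T)) (tip_view T)),
      tip_sig T = Some (Sig (leader (tip_view T)) (CProposal (tip_pid T)))
    & exists k e, List.In e (hist (C k)) /\ List.In T (tips_of (body e))].

Definition leader_equivocated (C : nat -> config) (v : nat) : Prop :=
  exists T1 T2, [/\ issued C T1, issued C T2, tip_view T1 = v, tip_view T2 = v
                  & tip_pid T1 <> tip_pid T2].

End MonadBFT.

(* Main.v *)
(** Any two quorums of [2f+1] signers share a correct validator.  Let a fresh
    proposal of view [u] with block [B0] be certified.  Every correct voter of
    [u] then holds a tip of view at least [u], and so does every valid TC of a
    view at least [u], unless it carries a QC of such a view.  By induction on
    the view, every fresh tip of a view above [u] has a QC of view at least [t]: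
    its TC provides one, or else an NEC signer among the voters of [u] does.
    - For the proposal whose QC commits its parent [G], take [t = u - 1]: the
      only certified block of view [t] is [G], so all certified blocks of view
      at least [t] extend [G].
    - For a speculatively finalized block [B], take [t = u].  If the leader of
      [u] did not equivocate, then [B] is the block of all tips of view [u], and
      no voter of [u] signed a no-endorsement of it; so all certified blocks of
      view at least [u] extend [B].
    A block that is committed by a QC pair of views [v], [v+1] with [v > u] hence
    extends [B], and if [v <= u] then [B] extends it. *)
From Stdlib Require Import Classical Relations Operators_Properties.
Require Import Defs.
From mathcomp Require Import all_boot all_order all_algebra.
From mathcomp Require Import zify.
Set Implicit Arguments.
Unset Strict Implicit.
Unset Printing Implicit Defensive.

(** * Blocks and certificates *)

Lemma In_nth (A : Type) (x0 x : A) (s : seq A) :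
  List.In x s -> exists2 i, i < size s & nth x0 s i = x.
Proof.
elim: s => //= y s IHs [->|/IHs[i lt_i <-]]; first by exists 0.
by exists i.+1.
Qed.

Lemma In_cat (A : Type) (x : A) (s1 s2 : seq A) :
  List.In x (s1 ++ s2) <-> List.In x s1 \/ List.In x s2.
Proof. exact: List.in_app_iff. Qed.

Section Blocks.

Context (R : realFieldType) (f : nat) (hash payload : Type).
Context (S : setting R f hash payload).

Implicit Types (B G : block f hash payload) (T : tip f hash) (c : tc f hash).

Lemma proposal_id_inj h1 v1 h2 v2 :
  hash_fun S (OfProposal f payload h1 v1) = hash_fun S (OfProposal f payload h2 v2) ->
  h1 = h2 /\ v1 = v2.
Proof. by move/(hash_inj (s:=S)) => [-> ->]. Qed.

Lemma header_inj (h1 h2 : header f hash) :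
  correct_block_hash S h1 -> correct_block_hash S h2 ->
  block_hash h1 = block_hash h2 -> h1 = h2.
Proof.
case: h1 h2 => [v1 p1 q1 b1] [v2 p2 q2 b2]; rewrite /correct_block_hash /=.
by move=> -> -> /(hash_inj (s:=S)) [-> -> ->].
Qed.

(** The part of validity that makes the block hash determine the block; it does not ask that the QC
    field be valid. *)
Definition sound_block B : Prop :=
  correct_block_hash S B /\ correct_payload_hash S B.

Lemma block_inj B1 B2 :
  sound_block B1 -> sound_block B2 -> block_hash B1 = block_hash B2 -> B1 = B2.
Proof.
move=> [h1 p1] [h2 p2] /(header_inj h1 h2) eqh.
case: B1 B2 eqh h1 p1 h2 p2 => [h1 x1] [h2 x2] /= -> _.
by rewrite /correct_payload_hash /= => -> _ /(hash_inj (s:=S)) [->].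
Qed.

Lemma sound_genesis : sound_block (genesis_block S).
Proof.
split; last exact: genesis_payload_hash.
by rewrite /correct_block_hash genesis_view genesis_block_hash.
Qed.

Lemma valid_header_hash (h : header f hash) :
  valid_header S h -> correct_block_hash S h.
Proof. by case=> [->|[]//]; case: sound_genesis. Qed.

Lemma valid_block_sound B : valid_block S B -> sound_block B.
Proof. by move=> [/valid_header_hash hB pB]. Qed.

Lemma parent_unique B1 B2 B : parent S B1 B -> parent S B2 B -> B1 = B2.
Proof.
move=> [p1 [[[pid1 h1 x1] e1] <-]] [p2 [[[pid2 h2 x2] e2] <-]].
apply: block_inj => //.
by move: e1; rewrite -e2 pid1 pid2 => /proposal_id_inj [].
Qed.

Lemma parent_of_hash B1 B :
  sound_block B1 ->
  qc_pid (hqc B) = hash_fun S (OfProposal f payload (qc_hash (hqc B)) (qc_view (hqc B))) ->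
  qc_hash (hqc B) = block_hash B1 ->
  parent S B1 B.
Proof.
move=> [hB1 pB1] pid eqh.
(* [points_to] asks for well-formedness only, so an unsigned proposal with the view and id of the QC
   is a witness, whether or not anyone issued it. *)
exists (Proposal (qc_view (hqc B)) (qc_pid (hqc B)) B1 None None None).
by split=> //; split=> //; split=> //=; rewrite pid eqh.
Qed.

(** Parents are unique, so the ancestors of a block form a chain. Both paths are peeled from their
    end at [G], where their last steps start from the same parent. *)
Lemma ancestors_comparable B1 B2 G :
  extends S G B1 -> extends S G B2 -> extends S B1 B2 \/ extends S B2 B1.
Proof.
rewrite /extends => /clos_rt_rtn1_iff.
elim=> [|P {}G PG /clos_rt_rtn1_iff B1P IH] B2G; first by left.
move/clos_rt_rtn1_iff: B2G => B2G; inversion B2G as [|P' ? P'G B2P']; subst.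
  by right; apply: Relation_Operators.rt_trans B1P _; exact: Relation_Operators.rt_step.
apply: IH; rewrite (parent_unique PG P'G); exact/clos_rt_rtn1_iff.
Qed.

(** A positive view excludes the genesis tip. The last clause separates the three sources of the QC
    of a fresh tip: the preceding view, a TC that carries it, or a TC with an NEC. *)
Lemma valid_fresh_tipP T :
  valid_fresh_tip S T -> 0 < tip_view T ->
  [/\ valid_header S (tip_header T),
      tip_pid T = hash_fun S (OfProposal f payload (block_hash (tip_header T)) (tip_view T)),
      tip_sig T = Some (Sig (leader f (tip_view T)) (CProposal (tip_pid T))),
      block_view (tip_header T) = tip_view T /\ qc_view (tip_qc T) < tip_view T
    & tip_view T = (qc_view (tip_qc T)).+1 /\ tip_tc T = None \/
      exists c, [/\ tip_tc T = Some c, valid_tc S c, tip_view T = (tc_view c).+1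
        & high_qc c = Some (tip_qc T) \/
          exists e, [/\ tip_nec T = Some e, valid_nec e, tip_view T = nec_view e
                      & qc_view (tip_qc T) = nec_qc_view e]]].
Proof.
case: T => v pid hd sg otc onec /= [[-> *] //|[hdP pidP sgP vP tcP]] _; split=> //.
rewrite /tip_qc /=; case: eqP tcP => [eqv [-> _]|_]; first by left.
case: otc => // c [cP vc necP]; right; exists c; split=> //.
by case: onec necP => [e [? ? ?]|]; [right; exists e|left].
Qed.

Lemma valid_tc_high_tip c T :
  valid_tc S c -> high_tip c = Some T ->
  [/\ valid_fresh_tip S T, tip_view T <= tc_view c & 0 < tip_view T].
Proof.
case: c => v tv ht qv hq sg /= [_ _ _ _ cP] eqT; subst ht.
by case: hq cP => // -[TP le_T _ /(leq_ltn_trans (leq0n _))].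
Qed.

Lemma valid_fresh_tip_block_view T :
  valid_fresh_tip S T -> block_view (tip_header T) = tip_view T.
Proof.
by case: T => v pid hd sg otc onec /= [[-> _ -> *]|[_ _ _ [] //]]; rewrite genesis_view.
Qed.

Lemma valid_tc_high_qc c q : valid_tc S c -> high_qc c = Some q -> high_tip c = None.
Proof. by case: c => v tv [T|] qv [q'|] sg //= []. Qed.

Lemma leq_max_seq (s : seq nat) x : x \in s -> x <= \max_(y <- s) y.
Proof. by move=> xs; apply: (leq_bigmax_seq (P := xpredT) (F := id)). Qed.

(** The position of a signature in the aggregate selects the entries of its signer in [tips_views]
    and [qcs_views]. In this form a single correct contributor constrains the whole TC. *)
Lemma valid_tc_report c s :
  valid_tc S c -> List.In s (tc_sigs c) ->
  exists tv qv, [/\ signed s = CTimeout hash (tc_view c) tv qv,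
    forall q, high_qc c = Some q ->
      odflt 0 tv <= qc_view q /\ qv <= qc_view q,
    forall T, high_tip c = Some T ->
      qv < tip_view T /\
      (forall t, tv = Some t ->
         t <= tip_view T /\ (t = tip_view T -> qv <= qc_view (tip_qc T)))
    & (exists q, high_qc c = Some q) \/ (exists T, high_tip c = Some T)].
Proof.
case: c => v tv ht qv hq sg /= [_ size_tv size_qv eq_sg cP] /(In_nth s) [i lt_i <-].
have size_sg : size sg = (2 * f).+1.
  by rewrite -(size_map (@signed _ _)) eq_sg size_map size_zip size_tv size_qv minnn.
exists (nth None tv i), (nth 0 qv i).
have -> : signed (nth s sg i) = CTimeout hash v (nth None tv i) (nth 0 qv i).
  rewrite -(nth_map s (signed s)) // eq_sg (nth_map (None, 0)) ?nth_zip //= ?size_tv //.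
  by rewrite size_zip size_tv size_qv minnn -size_sg.
rewrite size_sg in lt_i.
have qv_i : nth 0 qv i <= max_qcs qv by apply: leq_max_seq; rewrite mem_nth ?size_qv.
have tv_i : odflt 0 (nth None tv i) <= max_tips tv.
  rewrite /max_tips -(big_map (odflt 0) xpredT id); apply: leq_max_seq.
  by apply: map_f; rewrite mem_nth ?size_tv.
case: hq ht cP => [q|] [T|] // [].
  move=> _ _ le_tv eq_qv; split=> // [q' [<-]|]; last by left; exists q.
  by rewrite {2}eq_qv (leq_trans tv_i).
move=> _ _ tvP lt_qv; split=> // [T' [<-]|]; last by right; exists T.
split=> [|t eq_t]; first exact: leq_ltn_trans lt_qv.
by have [] := tvP i t; rewrite ?size_tv.
Qed.

Lemma valid_tc_aggregate c : valid_tc S c -> aggregate (tc_sigs c).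
Proof. by case: c => v tv ht qv hq sg /= []. Qed.

(** Two sets of [2f+1] among [3f+1] validators meet in at least [f+1], and at most [f] are
    Byzantine. *)
Lemma quorum_intersection (s1 s2 : seq (signature f hash)) :
  aggregate s1 -> aggregate s2 ->
  exists i sg1 sg2, [/\ correct S i, List.In sg1 s1, List.In sg2 s2,
                        signer sg1 = i & signer sg2 = i].
Proof.
have mem_signer (s : seq (signature f hash)) i :
    i \in [seq signer sg | sg <- s] -> exists2 sg, List.In sg s & signer sg = i.
  elim: s => //= sg s IHs; rewrite inE => /orP[/eqP->|/IHs[sg' ? <-]].
    by exists sg => //; left.
  by exists sg' => //; right.
move=> [size1 uniq1] [size2 uniq2].
set A := [set i in [seq signer sg | sg <- s1]]; set B := [set i in [seq signer sg | sg <- s2]].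
have cardA : #|A| = (2 * f).+1 by rewrite cardsE (card_uniqP uniq1) size_map.
have cardB : #|B| = (2 * f).+1 by rewrite cardsE (card_uniqP uniq2) size_map.
have : ~~ (A :&: B \subset byz S).
  apply/negP => /subset_leq_card; have := byz_le S.
  have leU : #|A :|: B| <= (3 * f).+1 by rewrite -[X in _ <= X]card_ord max_card.
  have := cardsUI A B; rewrite cardA cardB; move: leU.
  move: #|A :|: B| #|A :&: B| #|byz S| => a b d; lia.
case/subsetPn => i; rewrite !inE => /andP[/mem_signer [sg1 ? ?] /mem_signer [sg2 ? ?]] ?.
by exists i, sg1, sg2.
Qed.

Lemma quorum_correct (s : seq (signature f hash)) :
  aggregate s -> exists2 sg, List.In sg s & correct S (signer sg).
Proof.
move=> qs; have [i [sg [_ [ci ? _ eq_i _]]]] := quorum_intersection qs qs.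
by exists sg; rewrite ?eq_i.
Qed.

End Blocks.

(** * Events of a validator *)

Section Events.

Context (R : realFieldType) (f : nat) (hash payload : Type).
Context (S : setting R f hash payload).

(* The history of a validator is a list of events, newest first.  A timeout is
   recorded with the local tip, for which it casts a vote; a refusal is a
   no-endorsement of the tip. *)
Inductive event :=
| ProposalVote (view : nat) (T : tip f hash)
| TimeoutVote (view : nat) (T : tip f hash) (last_qc_view : nat)
| Refusal (view : nat) (T : tip f hash).

Definition event_view (x : event) : nat :=
  match x with ProposalVote w _ | TimeoutVote w _ _ | Refusal w _ => w end.

(** Votes and timeouts raise [highest_voted_view]; refusals do not. *)
Definition is_ballot (x : event) : bool := if x is Refusal _ _ then false else true.

Implicit Types (T : tip f hash) (c : tc f hash) (sg : signature f hash) (e : seq event).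

Definition pid_of (h : hash) (v : nat) : hash := hash_fun S (OfProposal f payload h v).

Fixpoint tip_after e : tip f hash :=
  match e with
  | [::] => genesis_tip S
  | ProposalVote _ T :: _ => T
  | _ :: e' => tip_after e'
  end.

(** A timeout counts as a vote for its local tip even when it reports a QC and carries no tip vote,
    so votes are over-approximated. *)
Definition casts e (w : nat) T : Prop :=
  List.In (ProposalVote w T) e \/ exists qv, List.In (TimeoutVote w T qv) e.

(** The trace that a signature of a correct validator leaves in its history. For timeouts, the
    comparison with the last QC view decides between reporting the tip and reporting the QC, as in
    [do_timeout]. *)
Definition made e sg : Prop :=
  match signed sg with
  | CVote w h _ => exists2 T, casts e w T & block_hash (tip_header T) = h
  | CProposal _ => True
  | CTimeout w tv qv => exists T q, List.In (TimeoutVote w T q) e /\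
      if tip_view T <= q then tv = None /\ qv = q
      else tv = Some (tip_view T) /\ qv = qc_view (tip_qc T)
  | CNoEndorsement w x => exists2 T, List.In (Refusal w T) e & qc_view (tip_qc T) = x
  end.

Lemma casts_cons x e w T :
  casts (x :: e) w T ->
  [\/ x = ProposalVote w T, exists q, x = TimeoutVote w T q | casts e w T].
Proof.
by case=> [[]|[q []]] ?;
  [constructor 1|constructor 3; left|constructor 2; exists q|constructor 3; right; exists q].
Qed.

Lemma made_incl e e' sg : List.incl e e' -> made e sg -> made e' sg.
Proof.
move=> le_e; rewrite /made; case: (signed sg) => //.
- move=> w h _ [T cT <-]; exists T => //.
  by case: cT => [/le_e|[q /le_e]]; [left|right; exists q].
- by move=> w tv qv [T [q [/le_e TV ?]]]; exists T, q.
- by move=> w x [T /le_e ? <-]; exists T.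
Qed.

(* [base] stands for the signatures and [known] for the tips that occur in the
   messages sent so far. *)
Definition justified (base : signature f hash -> Prop) (known : tip f hash -> Prop)
    (w : nat) T : Prop :=
  exists c, [/\ valid_tc S c, w = (tc_view c).+1, high_tip c = Some T, known T
              & forall sg, List.In sg (sigs_of_tc c) -> base sg].

(** The last clause distinguishes fresh proposals from reproposals. The block supplies a payload for
    the header, so that a certified hash names an actual block. *)
Definition votable base known (w : nat) T : Prop :=
  [/\ valid_fresh_tip S T, known T,
      exists2 B : block f hash payload, sound_block S B & bheader B = tip_header T
    & tip_view T = w \/ justified base known w T].

(** The discipline that the code imposes on a history. A proposal vote is strictly newer than every
    earlier ballot, whereas a timeout may share the view of an earlier vote but only repeats the
    local tip. *)
Fixpoint lawful base known e : Prop :=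
  match e with
  | [::] => True
  | x :: e' =>
    [/\ lawful base known e', 0 < event_view x,
        forall y, List.In y e' -> event_view y <= event_view x
      & match x with
        | ProposalVote w T => votable base known w T /\
            forall y, List.In y e' -> is_ballot y -> event_view y < w
        | TimeoutVote _ T _ => T = tip_after e'
        | Refusal w T => justified base known w T /\
            forall w' T', List.In (ProposalVote w' T') e' ->
              tip_pid T <> pid_of (block_hash (tip_header T')) w'
        end]
  end.

Lemma justified_mono base known base' known' w T :
  (forall sg, base sg -> base' sg) -> (forall T', known T' -> known' T') ->
  justified base known w T -> justified base' known' w T.
Proof.
move=> leb lek [c [vc -> hT kT bc]]; exists c; split=> //; first exact: lek.
by move=> sg /bc /leb.
Qed.

Lemma lawful_mono base known base' known' e :
  (forall sg, base sg -> base' sg) -> (forall T', known T' -> known' T') ->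
  lawful base known e -> lawful base' known' e.
Proof.
move=> leb lek; elim: e => //= x e IHe [/IHe le_e x_gt0 ord xP]; split=> //.
case: x xP {x_gt0 ord} => [w T [[vT kT sT wT] lt_w]|//|w T [jT nT]].
  split=> //; split=> //; first exact: lek.
  by case: wT => [|/(justified_mono leb lek)]; [left|right].
by split=> //; apply: justified_mono jT.
Qed.

(** * Votes and refusals in a lawful history *)

Section Lawful.

Context (base : signature f hash -> Prop) (known : tip f hash -> Prop).

Lemma justified_view w T : justified base known w T -> tip_view T < w.
Proof. by move=> [c [vc -> hT _ _]]; have [] := valid_tc_high_tip vc hT. Qed.

Lemma votable_view w T : votable base known w T -> tip_view T <= w.
Proof. by move=> [_ _ _ [->//|/justified_view/ltnW]]. Qed.

Lemma lawful_gt0 e x : lawful base known e -> List.In x e -> 0 < event_view x.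
Proof. by elim: e => //= y e IHe [le_e y_gt0 _ _] [<-//|]; apply: IHe. Qed.

Lemma lawful_vote e w T :
  lawful base known e -> List.In (ProposalVote w T) e -> votable base known w T.
Proof.
by elim: e => //= x e IHe [le_e _ _ xP] [eqx|]; [move: xP; rewrite eqx => -[]|apply: IHe].
Qed.

Lemma lawful_refusal e w T :
  lawful base known e -> List.In (Refusal w T) e -> justified base known w T.
Proof.
by elim: e => //= x e IHe [le_e _ _ xP] [eqx|]; [move: xP; rewrite eqx => -[]|apply: IHe].
Qed.

(** Views never decrease along a history, so a vote of a smaller view precedes the refusal and was
    on record when the refused tip was checked. *)
Lemma refusal_after_vote e w T w' T' :
  lawful base known e -> List.In (Refusal w T) e -> List.In (ProposalVote w' T') e ->
  w' < w -> tip_pid T <> pid_of (block_hash (tip_header T')) w'.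
Proof.
elim: e => //= x e IHe [le_e _ ord xP] [eqx|inR] [eqx'|inV] lt_w.
- by rewrite eqx in eqx'.
- by move: xP; rewrite eqx => -[_]; apply.
- by have := ord _ inR; rewrite eqx' /= leqNgt lt_w.
- exact: IHe.
Qed.

Lemma tip_after_vote e :
  tip_after e = genesis_tip S \/ exists w, List.In (ProposalVote w (tip_after e)) e.
Proof.
elim: e => [|[w T|w T q|w T] e IHe] /=; first by left.
- by right; exists w; left.
- by case: IHe => [|[w' ?]]; [left|right; exists w'; right].
- by case: IHe => [|[w' ?]]; [left|right; exists w'; right].
Qed.

(** After the vote of view [u] the local tip is replaced only by later proposal votes, whose views
    are at least [u]. *)
Lemma tip_after_recent e u T :
  lawful base known e -> List.In (ProposalVote u T) e ->
  exists2 w, u <= w & List.In (ProposalVote w (tip_after e)) e.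
Proof.
elim: e => //= x e IHe [le_e _ ord xP] [eqx|inV].
  by rewrite eqx; exists u => //; left.
have [w le_w inV'] := IHe le_e inV.
case: x ord xP => [w' T'|w' T' q|w' T'] ord xP; try by exists w => //; right.
by exists w' => /=; [apply: ord inV|left].
Qed.

Lemma casts_vote e w T :
  lawful base known e -> casts e w T ->
  T = genesis_tip S \/ exists2 w', w' <= w & List.In (ProposalVote w' T) e.
Proof.
elim: e => [_ [//|[]//]|x e IHe] /= [le_e _ ord xP] cT.
have [eqx|[q eqx]|] := casts_cons cT.
- by right; exists w => //; left.
- move: xP ord; rewrite eqx => -> ord.
  have [|[w' inV]] := tip_after_vote e; first by left.
  by right; exists w'; [apply: ord inV|right].
by move/(IHe le_e) => [|[w' ? ?]]; [left|right; exists w' => //; right].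
Qed.

(** This is used for a voter of view [u] found by quorum intersection: whatever it supports from
    view [u] on, be it in a vote or a timeout, stems from a proposal it voted on no earlier than
    [u]. *)
Lemma casts_recent e u T0 w T :
  lawful base known e -> List.In (ProposalVote u T0) e -> u <= w -> casts e w T ->
  exists2 w', u <= w' <= w & List.In (ProposalVote w' T) e.
Proof.
elim: e => [_ []//|x e IHe] /= [le_e _ ord xP] inV le_u cT.
have [eqx|[q eqx]|{}cT] := casts_cons cT.
- by exists w; [rewrite le_u leqnn|left].
- move: xP ord inV; rewrite eqx => -> ord [//|inV].
  have [w' le_w' inV'] := tip_after_recent le_e inV.
  by exists w'; [rewrite le_w'; apply: ord inV'|right].
case: inV => [eqx|inV]; last first.
  by have [w' ? ?] := IHe le_e inV le_u cT; exists w' => //; right.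
(* A ballot older than the proposal vote of view [u] has a view below [u], contrary to [u <= w]. *)
move: xP; rewrite eqx => -[_ ltu]; suff : w < u by rewrite ltnNge le_u.
by case: cT => [inV|[q inV]]; have := ltu _ inV; apply.
Qed.

Lemma tip_after_casts e w T :
  lawful base known e -> casts e w T ->
  (forall y, List.In y e -> event_view y <= w) -> tip_after e = T.
Proof.
elim: e => [_ [//|[]//]|x e IHe] /= [le_e _ _ xP] cT lew.
have [->//|[q eqx]|{}cT] := casts_cons cT.
- by move: xP; rewrite eqx => ->.
have -> : tip_after e = T by apply: IHe => // y iny; apply: lew; right.
case: x xP lew => // w' T' [_ ltw] /(_ (ProposalVote w' T') (or_introl erefl)) /= le_w'.
suff : w < w' by rewrite ltnNge le_w'.
by case: cT => [inV|[q inV]]; have := ltw _ inV; apply.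
Qed.

(** A proposal vote is never preceded by a ballot of its own view, and a timeout repeats the local
    tip, which a vote of the same view has just set or which is unchanged since an earlier
    timeout. *)
Lemma casts_unique e w T1 T2 :
  lawful base known e -> casts e w T1 -> casts e w T2 -> T1 = T2.
Proof.
elim: e => [_ [//|[]//]|x e IHe] /= [le_e _ ord xP] c1 c2.
have old T T' : x = ProposalVote w T' -> ~ casts e w T.
  move=> eqx cT; move: xP; rewrite eqx => -[_ ltw].
  by case: cT => [inV|[q inV]]; have := ltw _ inV isT; rewrite ltnn.
have after T T' q : x = TimeoutVote w T' q -> casts e w T -> T' = T.
  move=> eqx cT; move: xP ord; rewrite eqx => -> ord.
  exact: tip_after_casts cT ord.
case/casts_cons: c1 => [eq1|[q1 eq1]|c1]; case/casts_cons: c2 => [eq2|[q2 eq2]|c2].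
- by move: eq2; rewrite eq1 => -[].
- by move: eq2; rewrite eq1.
- by case: (old T2 T1).
- by move: eq2; rewrite eq1.
- by move: eq2; rewrite eq1 => -[].
- exact: after eq1 c2.
- by case: (old T1 T2).
- by rewrite (after _ _ _ eq2 c1).
- exact: IHe.
Qed.

End Lawful.

End Events.

(** * Safety in a snapshot of an execution *)

Section Snapshot.

Context (R : realFieldType) (f : nat) (hash payload : Type).
Context (S : setting R f hash payload).
Context (base : signature f hash -> Prop) (known : tip f hash -> Prop).
Context (ev : validator f -> seq (event f hash)).

Implicit Types (T : tip f hash) (c : tc f hash) (q : qc f hash).
Implicit Types (B : block f hash payload) (p : proposal f hash payload).

Definition known_qc q : Prop := forall sg, List.In sg (qc_sigs q) -> base sg.

Definition known_tc c : Prop :=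
  (forall sg, List.In sg (sigs_of_tc c) -> base sg) /\
  (forall T, high_tip c = Some T -> known T).

(** All that the safety argument uses of a configuration: lawful histories, signatures of correct
    validators accounted for, and closure of the known objects under nesting. *)
Record snapshot : Prop := Snapshot {
  snapshot_lawful : forall i, correct S i -> lawful S base known (ev i);
  snapshot_made : forall sg, base sg -> correct S (signer sg) -> made (ev (signer sg)) sg;
  snapshot_sigs : forall T sg, known T -> List.In sg (sigs_of_tip T) -> base sg;
  snapshot_tc : forall T c, known T -> tip_tc T = Some c -> known_tc c }.

Context (snap : snapshot).

Lemma known_tip_qc T : known T -> known_qc (tip_qc T).
Proof.
move=> kT sg sgq; apply: (snapshot_sigs snap kT).
by case: T sgq {kT} => * /=; apply/In_cat; left.
Qed.

Lemma known_tip_nec T e sg :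
  known T -> tip_nec T = Some e -> List.In sg (nec_sigs e) -> base sg.
Proof.
move=> kT eqe sge; apply: (snapshot_sigs snap kT).
by case: T eqe {kT} => ? ? ? ? ? ? /= ->; do 3!(apply/In_cat; right).
Qed.

Lemma known_tc_sigs c sg : known_tc c -> List.In sg (tc_sigs c) -> base sg.
Proof.
move=> [bc _] sgc; apply: bc.
by case: c sgc => * /=; do 2!(apply/In_cat; right).
Qed.

Lemma justified_known w T :
  justified S base known w T ->
  exists c, [/\ valid_tc S c, w = (tc_view c).+1, high_tip c = Some T & known_tc c].
Proof.
move=> [c [vc eqw hT kT bc]]; exists c; split=> //; split=> // T'.
by rewrite hT => -[<-].
Qed.

Lemma signed_qc_casts q sg :
  known_qc q -> signed_qc S q -> List.In sg (qc_sigs q) -> correct S (signer sg) ->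
  exists2 T, casts (ev (signer sg)) (qc_view q) T & block_hash (tip_header T) = qc_hash q.
Proof.
move=> kq [_ _ sq] sgq csg.
by have := snapshot_made snap (kq _ sgq) csg; rewrite /made (sq _ sgq).
Qed.

(** Some signer is correct, and its events have positive views. This separates signed QCs from the
    genesis QC. *)
Lemma signed_qc_gt0 q : known_qc q -> signed_qc S q -> 0 < qc_view q.
Proof.
move=> kq sq; have [_ aq _] := sq; have [sg sgq csg] := quorum_correct S aq.
have [T cT _] := signed_qc_casts kq sq sgq csg.
by case: cT => [inV|[r inV]]; apply: (lawful_gt0 (snapshot_lawful snap csg) inV).
Qed.

(** Two QCs of one view share a correct voter, which supports a single tip in that view. *)
Lemma certified_hash_unique q1 q2 :
  known_qc q1 -> valid_qc S q1 -> known_qc q2 -> valid_qc S q2 ->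
  qc_view q1 = qc_view q2 -> qc_hash q1 = qc_hash q2.
Proof.
move=> k1 [->|s1] k2 [->|s2] // eqv.
- by have := signed_qc_gt0 k2 s2; rewrite -eqv.
- by have := signed_qc_gt0 k1 s1; rewrite eqv.
have [_ a1 _] := s1; have [_ a2 _] := s2.
have [i [sg1 [sg2 [ci in1 in2 eq1 eq2]]]] := quorum_intersection S a1 a2.
have [|T1 c1 <-] := signed_qc_casts k1 s1 in1; first by rewrite eq1.
have [|T2 c2 <-] := signed_qc_casts k2 s2 in2; first by rewrite eq2.
rewrite eq1 eqv in c1; rewrite eq2 in c2.
by rewrite (casts_unique (snapshot_lawful snap ci) c1 c2).
Qed.

(** Even a QC formed from tip votes has a correct signer whose tip is genesis or goes back to a
    proposal vote, made on a proposal with a full block. *)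
Lemma certified_block q :
  known_qc q -> valid_qc S q -> exists2 B, sound_block S B & block_hash B = qc_hash q.
Proof.
move=> kq [->|sq]; first by exists (genesis_block S) => //; exact: sound_genesis.
have [_ aq _] := sq; have [sg sgq csg] := quorum_correct S aq.
have [T cT <-] := signed_qc_casts kq sq sgq csg.
have [->|[w _ inV]] := casts_vote (snapshot_lawful snap csg) cT.
  by exists (genesis_block S) => //; exact: sound_genesis.
have [_ _ [B sB eqB] _] := lawful_vote (snapshot_lawful snap csg) inV.
by exists B; rewrite // eqB.
Qed.

Lemma certified_parent q B B1 :
  valid_qc S q -> hqc B = q -> sound_block S B1 -> block_hash B1 = qc_hash q ->
  parent S B1 B.
Proof.
move=> vq eqq s1 eq1; apply: parent_of_hash; rewrite ?eqq //.
by case: vq => [->|[]].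
Qed.

(** * Consequences of a certified fresh block *)

Section Certified.

Context (u : nat) (q0 : qc f hash) (B0 : block f hash payload).
Context (q0_signed : signed_qc S q0) (q0_known : known_qc q0).
Context (q0_view : qc_view q0 = u) (q0_hash : qc_hash q0 = block_hash B0).
Context (B0_sound : sound_block S B0) (B0_view : block_view B0 = u).

Lemma certified_view_gt0 : 0 < u.
Proof. by rewrite -q0_view; apply: signed_qc_gt0. Qed.

(** The tip of such a voter has view [u], the block view of [B0], and no vote before view [u] can
    set it. So the voter voted on a proposal in view [u], even if its signature in [q0] came from a
    timeout. *)
Lemma certified_voter sg :
  List.In sg (qc_sigs q0) -> correct S (signer sg) ->
  exists2 T, List.In (ProposalVote u T) (ev (signer sg)) & tip_header T = bheader B0.
Proof.
move=> sgq csg; have [T cT eqh] := signed_qc_casts q0_known q0_signed sgq csg.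
rewrite q0_view in cT; rewrite q0_hash in eqh.
have hB0 : correct_block_hash S B0 by case: B0_sound.
have [eqT|[w le_w inV]] := casts_vote (snapshot_lawful snap csg) cT.
  have gB0 : bheader (genesis_block S) = B0.
    by apply: (header_inj (S := S)) => //; [case: (sound_genesis S)|rewrite -eqh eqT].
  by have := certified_view_gt0; rewrite -B0_view -gB0 genesis_view.
have vT := lawful_vote (snapshot_lawful snap csg) inV; have le_T := votable_view vT.
have [fT _ [B [hB _] eqB] _] := vT.
have eqT : tip_header T = B0 by apply: (header_inj (S := S)) => //; rewrite -eqB.
exists T => //; suff -> : u = w by [].
apply/eqP; rewrite eqn_leq le_w andbT.
by rewrite -B0_view -eqT (valid_fresh_tip_block_view fT).
Qed.

(* [D] refines what is known of the tips of view [u]; [t] bounds from below the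
   QC views of all later fresh tips. *)
Context (t : nat) (D : tip f hash -> Prop).
Context (t_le : t <= u).
Context (D_header : forall T, tip_header T = bheader B0 -> D T).
Context (D_tie : forall T T',
  known T' -> valid_fresh_tip S T' -> tip_view T' = u ->
  D T -> qc_view (tip_qc T) <= qc_view (tip_qc T') -> D T').
Context (D_refused : forall T,
  known T -> valid_fresh_tip S T -> tip_view T = u -> D T ->
  tip_pid T <> pid_of S (block_hash B0) u -> t <= qc_view (tip_qc T)).

(** The induction invariant for the tips that voters of view [u] hold, and that TCs carry, from view
    [u] on. *)
Definition good T : Prop :=
  [/\ known T, valid_fresh_tip S T, u <= tip_view T, tip_view T = u -> D T
    & u < tip_view T -> t <= qc_view (tip_qc T)].

Definition tc_good (w : nat) : Prop :=
  forall c, valid_tc S c -> known_tc c -> tc_view c = w ->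
  (exists2 q, high_qc c = Some q & u <= qc_view q) \/
  (exists2 T, high_tip c = Some T & good T).

(** Case analysis on the source of the QC: the preceding view is at least [u], a QC in the TC is
    covered by the hypothesis on TCs, and an NEC is handled through a signer common to it and
    [q0]. *)
Lemma later_fresh_tip w T :
  (forall w', u <= w' < w -> tc_good w') ->
  known T -> valid_fresh_tip S T -> u < tip_view T <= w -> t <= qc_view (tip_qc T).
Proof.
move=> IH kT vT /andP[lt_u le_w].
have [_ _ _ _ [[eqv _]|[c [tcT vc eqv ncP]]]] := valid_fresh_tipP vT (leq_ltn_trans (leq0n u) lt_u).
  by apply: leq_trans t_le _; rewrite -ltnS -eqv.
have IHc : tc_good (tc_view c) by apply: IH; move: lt_u le_w; rewrite eqv ltnS => -> ->.
have kc := snapshot_tc snap kT tcT.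
case: ncP => [hq|[e [eT [_ ae se] eqe eqx]]].
  case: (IHc c vc kc erefl) => [[q hq' le_u]|[T' hT']].
    by apply: leq_trans t_le _; move: hq'; rewrite hq => -[->].
  by rewrite (valid_tc_high_qc vc hq) in hT'.
have [_ a0 _] := q0_signed.
have [i [sg1 [sg2 [ci in1 in2 eq1 eq2]]]] := quorum_intersection S ae a0.
have [|T0 inV hT0] := certified_voter in2; first by rewrite eq2.
have := snapshot_made snap (known_tip_nec kT eT in1); rewrite eq1 => /(_ ci).
rewrite /made (se _ in1) -eqe -eqx => -[T' inR <-]; rewrite eq2 in inV.
have li := snapshot_lawful snap ci.
(* The TC shown to the refusing signer has the view of the TC in [T] but may be a different one; the
   hypothesis on TCs applies to it as well. *)
have [c' [vc' eqw hT' kc']] := justified_known (lawful_refusal li inR).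
have IHc' : tc_good (tc_view c').
  by apply: IH; move: lt_u le_w; rewrite eqw ltnS => -> ->.
case: (IHc' c' vc' kc' erefl) => [[q /(valid_tc_high_qc vc')]|[T'']]; first by rewrite hT'.
rewrite hT' => -[<-] [kT' vT' le_u dT'].
case: (ltnP u (tip_view T')) => [_|le_T' _]; first by apply.
have eqT' : tip_view T' = u by apply/eqP; rewrite eqn_leq le_T' le_u.
apply: D_refused => //; first exact: dT'.
(* The signer voted for [B0] in view [u] before refusing, so the refused tip has another proposal
   id. *)
by rewrite -hT0; apply: (refusal_after_vote li inR inV).
Qed.

(** In view [u] the voter supports only [B0]. A later vote is either for a fresh tip, bounded by
    [later_fresh_tip], or for a reproposal, whose tip is the high tip of a TC of the preceding
    view. *)
Lemma later_vote w i w' T :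
  (forall w'', u <= w'' < w -> tc_good w'') ->
  (exists2 sg, List.In sg (qc_sigs q0) & signer sg = i) -> correct S i ->
  List.In (ProposalVote w' T) (ev i) -> u <= w' <= w -> good T.
Proof.
move=> IH [sg sgq eqi] ci inV /andP[le_u le_w].
have li := snapshot_lawful snap ci.
have [fT kT _ jT] := lawful_vote li inV.
move: le_u; rewrite leq_eqVlt => /orP[/eqP eqw|lt_u].
  have [|T0 inV0 hT0] := certified_voter sgq; first by rewrite eqi.
  rewrite -eqw in inV; rewrite eqi in inV0.
  have eqT : T = T0 by apply: (casts_unique li) (or_introl inV) (or_introl inV0).
  have vT : tip_view T = u by rewrite -(valid_fresh_tip_block_view fT) eqT hT0.
  by split=> //; rewrite ?vT ?ltnn // => _; apply: D_header; rewrite eqT.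
case: jT => [eqT|/justified_known [c [vc eqw hT kc]]].
  split=> //; first by rewrite eqT ltnW.
    by rewrite eqT => eqw; rewrite eqw ltnn in lt_u.
  by move=> _; apply: (later_fresh_tip IH) => //; rewrite eqT lt_u.
have IHc : tc_good (tc_view c) by apply: IH; move: lt_u le_w; rewrite eqw ltnS => -> ->.
case: (IHc c vc kc erefl) => [[q /(valid_tc_high_qc vc)]|[T']]; first by rewrite hT.
by rewrite hT => -[<-].
Qed.

(** Strong induction on the view. A contributor that also signed [q0] holds a good tip, because TCs
    of smaller views suffice for [later_vote]; its report then forces the content of the TC. *)
Lemma later_tc w : u <= w -> tc_good w.
Proof.
elim/ltn_ind: w => w IH le_u c vc kc eqw.
have {}IH w' : u <= w' < w -> tc_good w' by case/andP=> ? ?; apply: IH.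
have [_ a0 _] := q0_signed.
have [i [sg1 [sg2 [ci in1 in2 eq1 eq2]]]] := quorum_intersection S (valid_tc_aggregate vc) a0.
have li := snapshot_lawful snap ci.
have [|T0 inV hT0] := certified_voter in2; first by rewrite eq2.
rewrite eq2 in inV.
have [tv [qv [eqsg hqP hTP hP]]] := valid_tc_report vc in1.
have := snapshot_made snap (known_tc_sigs kc in1); rewrite eq1 => /(_ ci).
rewrite /made eqsg eqw => -[T [x [inT repT]]].
have [w' le_w' inV'] := casts_recent li inV le_u (or_intror (ex_intro _ x inT)).
have [kT vT leT dT tT] : good T by apply: (later_vote IH _ ci inV' le_w'); exists sg2.
case: hP => [[q hq]|[T' hT']].
  left; exists q => //; have [] := hqP q hq.
  (* The reported tip or QC has view at least [u], and the high QC is at least as high as either. *)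
  case: ifP repT => [le_x [-> ->]|_ [-> ->]] /= le1 le2.
    by rewrite (leq_trans leT) // (leq_trans le_x).
  exact: leq_trans le1.
right; exists T' => //; have [fT' leT' _] := valid_tc_high_tip vc hT'.
have kT' : known T' by case: kc => _; apply.
have [lt_qv tvP] := hTP _ hT'.
have leu' : u <= tip_view T' /\ (tip_view T' = u -> D T').
  (* A reported QC has view at least [u] and lies strictly below the high tip. A reported tip is at
     most the high tip; if both have view [u], the tie-breaking rule on QC views transfers [D]. *)
  case: ifP repT => [le_x [eqt eqq]|_ [eqt eqq]].
    have lt_u : u < tip_view T'.
      by rewrite eqq in lt_qv; apply: leq_ltn_trans lt_qv; apply: leq_trans le_x.
    by split; [apply: ltnW|move=> eqT'; rewrite eqT' ltnn in lt_u].
  have [le_t tie] := tvP _ eqt; split=> [|eqT']; first exact: leq_trans le_t.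
  have eqT : tip_view T = u by apply/eqP; rewrite eqn_leq leT -eqT' le_t.
  by apply: D_tie (dT eqT) _ => //; rewrite -eqq tie ?eqT ?eqT'.
case: leu' => leu' dT'; split=> //.
by move=> lt_u; apply: (later_fresh_tip IH) => //; rewrite lt_u -eqw.
Qed.

Lemma later_qc q :
  valid_qc S q -> known_qc q -> u <= qc_view q ->
  exists T, [/\ good T, tip_view T <= qc_view q & block_hash (tip_header T) = qc_hash q].
Proof.
move=> [->|sq] kq le_u; first by have := leq_trans certified_view_gt0 le_u.
have [_ aq _] := sq; have [_ a0 _] := q0_signed.
have [i [sg1 [sg2 [ci in1 in2 eq1 eq2]]]] := quorum_intersection S aq a0.
have li := snapshot_lawful snap ci.
have [|T0 inV hT0] := certified_voter in2; first by rewrite eq2.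
have [|T cT eqh] := signed_qc_casts kq sq in1; first by rewrite eq1.
rewrite eq1 in cT; rewrite eq2 in inV.
have [w' le_w' inV'] := casts_recent li inV le_u cT.
exists T; split=> //; last first.
  by case/andP: le_w' => _; apply: leq_trans; apply: votable_view (lawful_vote li inV').
apply: (later_vote (w := qc_view q) _ _ ci inV' le_w'); last by exists sg2.
by move=> w'' /andP[le_u'' _]; apply: later_tc.
Qed.

Context (X : block f hash payload).
Context (D_split : forall T, D T -> tip_header T = bheader B0 \/ t <= qc_view (tip_qc T)).
Context (B0_extends : extends S B0 X).
Context (X_sound : sound_block S X).
Context (X_certified : forall q,
  valid_qc S q -> known_qc q -> t <= qc_view q < u -> qc_hash q = block_hash X).

(** [X] is the block to be protected: either [B0] or an ancestor reached through its QC. Strong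
    induction on the view of the QC follows parents down until [B0] or a view below [u] is
    reached. *)
Lemma later_certified_extends q B :
  valid_qc S q -> known_qc q -> t <= qc_view q ->
  sound_block S B -> block_hash B = qc_hash q -> extends S B X.
Proof.
move: {2}(qc_view q) (erefl (qc_view q)) => w.
elim/ltn_ind: w q B => w IH q B eqw vq kq le_t sB eqB.
case: (ltnP (qc_view q) u) => [lt_u|le_u].
  have -> : B = X by apply: (block_inj sB X_sound); rewrite eqB (X_certified vq kq) // le_t.
  exact: Relation_Operators.rt_refl.
have [T [[kT fT leT dT tT] lew eqh]] := later_qc vq kq le_u.
have T_gt0 : 0 < tip_view T := leq_trans certified_view_gt0 leT.
have [vh _ _ [_ ltT] _] := valid_fresh_tipP fT T_gt0.
have hB : bheader B = tip_header T.
  by case: sB => hB _; apply: (header_inj hB (valid_header_hash vh)); rewrite eqB.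
(* The parent of [B] is certified by the QC of [T], whose view is smaller but still at least [t], so
   the induction hypothesis applies to it. *)
have up : t <= qc_view (tip_qc T) -> extends S B X.
  move=> le_t'.
  have kqT := known_tip_qc kT.
  have vqT : valid_qc S (tip_qc T).
    case: vh => [eqT|[]//]; have := valid_fresh_tip_block_view fT.
    by rewrite eqT genesis_view => eq0; rewrite -eq0 in T_gt0.
  have [P sP eqP] := certified_block kqT vqT.
  have PB : parent S P B by apply: (certified_parent vqT) => //; rewrite hB.
  apply: Relation_Operators.rt_trans (Relation_Operators.rt_step _ _ _ _ PB).
  by apply: (IH _ _ _ _ erefl) eqP => //; rewrite -eqw (leq_trans ltT).
move: leT; rewrite leq_eqVlt => /orP[/eqP eqT|/tT//].
case: (D_split (dT (esym eqT))) => [eqh0|//].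
by have -> : B = B0 by apply: (block_inj sB B0_sound); rewrite hB eqh0.
Qed.

End Certified.

End Snapshot.

(** * The protocol preserves the invariant *)

Lemma In_map (A B : Type) (g : A -> B) (s : seq A) y :
  List.In y (map g s) <-> exists2 x, List.In x s & y = g x.
Proof.
elim: s => [|x s [IHl IHr]] /=; first by split=> // -[].
split=> [[<-|/IHl[z ? ->]]|[z [<-|zs] eqy]]; first by exists x => //; left.
- by exists z => //; right.
- by left.
by right; apply: IHr; exists z.
Qed.

Lemma In_filter (A : Type) (a : pred A) (s : seq A) x :
  List.In x (filter a s) -> List.In x s.
Proof.
elim: s => //= y s IHs; case: ifP => _ /=; last by right; apply: IHs.
by case=> [->|/IHs]; [left|right].
Qed.

Section Invariant.

Context (R : realFieldType) (f : nat) (hash payload : Type).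
Context (S : setting R f hash payload).
Context (self : validator f) (now : R) (sent : proposal f hash payload -> Prop).
Context (base : signature f hash -> Prop) (known : tip f hash -> Prop).

Implicit Types (T : tip f hash) (c : tc f hash) (q : qc f hash) (m : msg f hash payload).
Implicit Types (B : block f hash payload) (p : proposal f hash payload).
Implicit Types (e : seq (event f hash)) (s : state R f hash payload).
Implicit Types (F : nat -> Prop) (n : note f hash payload).

Local Notation cmd := (cmd R f hash payload).

Definition sigs_known (l : seq (signature f hash)) : Prop :=
  forall sg, List.In sg l -> base sg.

Lemma sigs_known_cat l1 l2 :
  sigs_known (l1 ++ l2) <-> sigs_known l1 /\ sigs_known l2.
Proof.
split=> [k12|[k1 k2] sg /In_cat[/k1|/k2]//].
by split=> sg sgl; apply: k12; apply/In_cat; [left|right].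
Qed.

Definition certified p q : Prop :=
  [/\ valid_proposal S p, known (tip_of p), valid_qc S q, sigs_known (qc_sigs q)
    & qc_pid q = prop_pid p].

(** For the two kinds of commit entries, the certified proposal behind the commit is retained, since
    the log does not record the triggering QC. *)
Definition justified_note n : Prop :=
  match n with
  | GotVote vt | GotTipVote vt => valid_vote S vt /\ base (vote_sig vt)
  | GotTimeout M => sigs_known (sigs_of_timeout M)
  | GotNE sg => base sg
  | Stored p => sigs_known (sigs_of_tip (tip_of p))
  | SpecCommitted p => fresh p /\ exists q, certified p q
  | Committed B => exists p q gp,
      [/\ certified p q, qc_view q = (qc_view (prop_qc p)).+1,
          points_to S (prop_qc p) gp & prop_block gp = B]
  | _ => True
  end.

(** Couples a local state with a ghost history. [inv_ballots] and [inv_views] turn the guards of the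
    handlers into order conditions on events, and [inv_voted] makes the check before a refusal
    complete. *)
Record inv e s : Prop := Inv {
  inv_local_tip : sigs_known (sigs_of_tip (local_tip s));
  inv_last_qc : sigs_known (qc_sigs (last_qc s));
  inv_last_tc : forall c, last_tc s = Some c -> sigs_known (sigs_of_tc c);
  inv_recoveries : forall r, List.In r (recoveries s) -> sigs_known (sigs_of_tc (rec_tc r));
  inv_log : forall n, logged n s -> justified_note n;
  inv_lawful : lawful S base known e;
  inv_tip_after : local_tip s = tip_after S e;
  inv_view_gt0 : 0 < cur_view s;
  inv_ballots : forall x, List.In x e -> is_ballot x -> event_view x <= highest_voted_view s;
  inv_views : forall x, List.In x e -> event_view x <= cur_view s;
  inv_voted : forall w T, List.In (ProposalVote w T) e ->
    logged (Voted f payload (pid_of S (block_hash (tip_header T)) w)) s }.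

Definition inv_on F e s : Prop := inv e s /\ F (cur_view s).

Definition out_ok e (o : seq (validator f * msg f hash payload)) : Prop :=
  forall j m sg, List.In (j, m) o -> List.In sg (sigs_of m) ->
    base sg \/ signer sg = self /\ made e sg.

(** A Hoare triple whose ghost history may only gain events; every signature sent is old or
    accounted for by the final history. *)
Definition triple (P Q : seq (event f hash) -> state R f hash payload -> Prop) (c : cmd) :=
  forall e s s' o, P e s -> c s s' o ->
  exists e', [/\ List.incl e e', Q e' s' & out_ok e' o].

(** [F] constrains the current view. Commands that do not enter a view preserve any [F], which
    carries the exact view across them. *)
Definition keeps F (c : cmd) : Prop := triple (inv_on F) (inv_on F) c.
Definition anyview : nat -> Prop := fun=> True.

Lemma out_ok_incl e e' o : List.incl e e' -> out_ok e o -> out_ok e' o.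
Proof.
move=> le_e oo j m sg io im; case: (oo j m sg io im) => [|[? ?]]; first by left.
by right; split=> //; apply: made_incl le_e _.
Qed.

(** * Rules for the command combinators *)

Lemma triple_seq P M Q (c1 c2 : cmd) :
  triple P M c1 -> triple M Q c2 -> triple P Q (andthen c1 c2).
Proof.
move=> t1 t2 e s s' o Pes [s1 [o1 [o2 [r1 r2 ->]]]].
have [e1 [le1 M1 out1]] := t1 _ _ _ _ Pes r1.
have [e2 [le2 Q2 out2]] := t2 _ _ _ _ M1 r2.
exists e2; split=> // [|j m sg /In_cat[io|io] im]; first exact: List.incl_tran le2.
  exact: out_ok_incl le2 out1 _ _ _ io im.
exact: out2 io im.
Qed.

Lemma keeps_seq F (c1 c2 : cmd) : keeps F c1 -> keeps F c2 -> keeps F (andthen c1 c2).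
Proof. exact: triple_seq. Qed.

Lemma keeps_skip F : keeps F (@skip R f hash payload).
Proof. by move=> e s s' o I [-> ->]; exists e; split. Qed.

Lemma keeps_ifelse F (P : state R f hash payload -> Prop) (c1 c2 : cmd) :
  (forall e s, inv e s -> P s -> keeps F c1) -> (forall e s, inv e s -> ~ P s -> keeps F c2) ->
  keeps F (ifelse P c1 c2).
Proof.
move=> k1 k2 e s s' o I [[Ps r]|[Ps r]].
  exact: k1 (proj1 I) Ps _ _ _ _ I r.
exact: k2 (proj1 I) Ps _ _ _ _ I r.
Qed.

Lemma keeps_when F (P : state R f hash payload -> Prop) (c : cmd) :
  (forall e s, inv e s -> P s -> keeps F c) -> keeps F (when P c).
Proof. by move=> k; apply: keeps_ifelse => // *; apply: keeps_skip. Qed.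

Lemma keeps_choosing F A (Q : state R f hash payload -> A -> Prop) (k : A -> cmd) :
  (forall e s x, inv e s -> Q s x -> keeps F (k x)) -> keeps F (choosing Q k).
Proof. by move=> kk e s s' o I [x [Qx r]]; apply: kk (proj1 I) Qx _ _ _ _ I r. Qed.

Lemma keeps_ifsome F A (Q : state R f hash payload -> A -> Prop) (k : A -> cmd) (c : cmd) :
  (forall e s x, inv e s -> Q s x -> keeps F (k x)) -> keeps F c -> keeps F (ifsome Q k c).
Proof. by move=> kk kc; apply: keeps_ifelse => // *; apply: keeps_choosing. Qed.

Lemma keeps_reading F (k : state R f hash payload -> cmd) :
  (forall e s, inv e s -> keeps F (k s)) -> keeps F (reading k).
Proof. by move=> kk e s s' o I r; apply: kk (proj1 I) _ _ _ _ I r. Qed.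

Lemma inv_add_note e s n : inv e s -> justified_note n -> inv e (add_note n s).
Proof.
case=> i1 i2 i3 i4 i5 i6 i7 i8 i9 i10 i11 jn; split=> //.
  by rewrite /logged /= => n' [<-|/i5].
by move=> w T /i11 ?; right.
Qed.

Lemma keeps_remember F n : justified_note n -> keeps F (remember n).
Proof.
move=> jn e s s' o [I Fs] [-> ->]; exists e.
by split=> //; split=> //; apply: inv_add_note.
Qed.

Lemma keeps_recoveries F (g : state R f hash payload -> seq (recovery R f hash)) :
  (forall e s, inv e s -> forall r, List.In r (g s) -> sigs_known (sigs_of_tc (rec_tc r))) ->
  keeps F (update (fun s => set_recoveries (g s) s)).
Proof.
move=> kg e s s' o [I Fs] [-> ->]; exists e.
split=> //.
by split=> //; case: (I) => *; split=> //; apply: kg I.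
Qed.

Definition sendable m : Prop := forall sg, List.In sg (sigs_of m) ->
  base sg \/ signer sg = self /\ forall e, made e sg.

Lemma keeps_send_to F (K : {set validator f}) m : sendable m -> keeps F (send_to K m).
Proof.
move=> sm e s s' o I [-> ->]; exists e; split=> //.
move=> j m' sg /In_map[i _ [_ ->]] /sm [|[? ?]]; first by left.
by right.
Qed.

Lemma keeps_send F m j : sendable m -> keeps F (send m j).
Proof.
move=> sm e s s' o I [-> ->]; exists e; split=> //.
by move=> j' m' sg [[_ <-]|//] /sm [|[? ?]]; [left|right].
Qed.

Lemma sendable_known m : sigs_known (sigs_of m) -> sendable m.
Proof. by move=> km sg /km; left. Qed.

Definition cert_known (c : cert f hash) : Prop := sigs_known (sigs_of_cert c).

Lemma inv_set_view e s (c : cert f hash) :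
  cert_known c -> cur_view s <= cert_view c -> inv e s -> inv e (set_view now c s).
Proof.
move=> kc le_c [i1 i2 i3 i4 i5 i6 i7 i8 i9 i10 i11]; split=> //=.
- by case: c kc {le_c}.
- by case: c kc {le_c} => // c kc c' [<-].
- by move=> x /i10 le_x; apply: leq_trans le_x (leqW le_c).
Qed.

Lemma keeps_Enter (c : cert f hash) :
  cert_known c -> keeps anyview (Enter (payload := payload) now c).
Proof.
move=> kc e s s' o [I _] [[le_c [-> ->]]|[_ [-> ->]]]; exists e.
  by split; [exact: List.incl_refl|split=> //; apply: inv_set_view|].
by split; [exact: List.incl_refl| |].
Qed.

(** Votes and refusals are signed for the current view, so the handlers need its exact value after
    entering. When [Enter] does nothing, the two inequalities already pin the view down. *)
Lemma triple_Enter (c : cert f hash) :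
  cert_known c ->
  triple (inv_on (fun v => v <= (cert_view c).+1)) (inv_on (eq (cert_view c).+1))
    (Enter (payload := payload) now c).
Proof.
move=> kc e s s' o [I le_c] [[le_s [-> ->]]|[lt_s [-> ->]]]; exists e.
  by split; [exact: List.incl_refl|split=> //; apply: inv_set_view|].
split; [exact: List.incl_refl|split=> //|by []].
by apply/eqP; rewrite eqn_leq le_c andbT ltnNge; apply/negP.
Qed.

Context (sent_known :
  forall p, sent p -> known (tip_of p) /\ sigs_known (sigs_of_tip (tip_of p))).

(* The QC field of the genesis block is invalid, but certifies nothing. *)
Definition committable q : Prop :=
  (valid_qc S q \/ q = hqc (genesis_block S)) /\ sigs_known (qc_sigs q).

Lemma obtainable_certified q p : committable q -> obtainable S sent q p -> certified p q.
Proof.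
move=> [vq kq] [/sent_known[kp _] vp eqp]; split=> //.
case: vq => // eqq; case: vp => _ pid _ _ _.
have := @genesis_no_parent _ _ _ _ S (block_hash (prop_block p)) (prop_view p).
by case; rewrite -eqq -eqp.
Qed.

(** * Preservation by the procedures *)

Lemma keeps_Commit F q : committable q -> keeps F (Commit S sent q).
Proof.
move=> cq; apply: keeps_ifsome => [e s p _ ob|]; last exact: keeps_skip.
have cp := obtainable_certified cq ob; have [/sent_known[_ kp] _ _] := ob.
apply: keeps_seq; first exact: keeps_remember.
apply: keeps_seq; apply: keeps_when => {e s} e s _.
  by move=> fp; apply: keeps_remember; split=> //; exists q.
move=> eqv; apply: keeps_choosing => _ _ gp _ pt.
apply: keeps_seq; first apply: keeps_when => _ _ _ [/sent_known[_ ?] _ _].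
  exact: keeps_remember.
by apply: keeps_remember; exists p, q, gp.
Qed.

Lemma keeps_issue F v B otc onec :
  sigs_known (qc_sigs (hqc B)) ->
  (forall c, otc = Some c -> sigs_known (sigs_of_tc c)) ->
  (forall ne, onec = Some ne -> sigs_known (nec_sigs ne)) ->
  keeps F (issue S self v B otc onec).
Proof.
move=> kB kc ke; apply: keeps_when => e s _ _.
apply: keeps_seq; first exact: keeps_remember.
apply: keeps_send_to => sg /= /In_cat[/kB|]; first by left.
case=> [<-|]; first by right.
case/In_cat => [|]; first by case: otc kc => // c /(_ c erefl) kc /kc; left.
by case: onec ke => // ne /(_ ne erefl) ke /ke; left.
Qed.

Lemma keeps_issue_new F v q otc onec :
  sigs_known (qc_sigs q) ->
  (forall c, otc = Some c -> sigs_known (sigs_of_tc c)) ->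
  (forall ne, onec = Some ne -> sigs_known (nec_sigs ne)) ->
  keeps F (issue_new S self v q otc onec).
Proof. by move=> *; apply: keeps_choosing => *; apply: keeps_issue. Qed.

Lemma keeps_ProposeQC F q : sigs_known (qc_sigs q) -> keeps F (ProposeQC S self q).
Proof. by move=> kq; apply: keeps_reading => *; apply: keeps_issue_new. Qed.

Lemma keeps_ask_more F c asked k :
  sigs_known (sigs_of_tc c) -> (forall K, keeps F (k K)) -> keeps F (ask_more S c asked k).
Proof.
move=> kc kk; apply: keeps_choosing => _ _ K _ _.
by apply: keeps_seq => //; apply: keeps_send_to; apply: sendable_known.
Qed.

Lemma keeps_Recover F c : sigs_known (sigs_of_tc c) -> keeps F (Recover S now c).
Proof.
move=> kc; apply: keeps_seq.
  by apply: keeps_send_to; apply: sendable_known.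
apply: keeps_ask_more => // K; apply: keeps_recoveries => e s I r /= [<-//|inr].
exact: inv_recoveries I _ (In_filter inr).
Qed.

Lemma keeps_finish_recovery F c : keeps F (finish_recovery (payload := payload) c).
Proof. by apply: keeps_recoveries => e s I r inr; apply: inv_recoveries I _ (In_filter inr). Qed.

Lemma sigs_of_high_qc c q : high_qc c = Some q -> List.incl (qc_sigs q) (sigs_of_tc c).
Proof.
case: c => v tv ht qv hq sg /= -> sg' ?; do 1!(apply/In_cat; right).
by apply/In_cat; left.
Qed.

Lemma sigs_of_high_tip c T : high_tip c = Some T -> List.incl (sigs_of_tip T) (sigs_of_tc c).
Proof. by case: c => v tv ht qv hq sg /= -> sg' ?; apply/In_cat; left. Qed.

Lemma sigs_of_tip_qc T : List.incl (qc_sigs (tip_qc T)) (sigs_of_tip T).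
Proof. by case: T => *; apply/List.incl_appl/List.incl_refl. Qed.

Lemma keeps_ProposeTC F c : sigs_known (sigs_of_tc c) -> keeps F (ProposeTC S self now c).
Proof.
move=> kc; rewrite /ProposeTC.
case hq: (high_qc c) => [q|].
  apply: keeps_reading => e s _; apply: keeps_issue_new => // [sg|c' [<-]//].
  by move/(sigs_of_high_qc hq)/kc.
case hT: (high_tip c) => [T|]; last exact: keeps_skip.
apply: keeps_ifsome => [e s p I [/(inv_log I) kp _]|]; last exact: keeps_Recover.
apply: keeps_reading => _ s' _; apply: keeps_issue => // [sg sgp|c' [<-]//].
exact/kp/(sigs_of_tip_qc (T := tip_of p)).
Qed.

Lemma keeps_Propose F (c : cert f hash) : cert_known c -> keeps F (Propose S self now c).
Proof. by case: c => [q|c] kc; [apply: keeps_ProposeQC|apply: keeps_ProposeTC]. Qed.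

Lemma keeps_BroadcastQC F q :
  sigs_known (qc_sigs q) -> keeps F (BroadcastQC (R := R) (payload := payload) q).
Proof.
move=> kq; apply: keeps_when => e s _ _.
by apply: keeps_seq; [apply: keeps_remember|apply: keeps_send_to; apply: sendable_known].
Qed.

Lemma keeps_BroadcastTC F c :
  sigs_known (sigs_of_tc c) -> keeps F (BroadcastTC (R := R) (payload := payload) c).
Proof.
move=> kq; apply: keeps_when => e s _ _.
by apply: keeps_seq; [apply: keeps_remember|apply: keeps_send_to; apply: sendable_known].
Qed.

Lemma last_certificate_known e s (c : cert f hash) :
  inv e s -> last_certificate s c -> cert_known c.
Proof.
move=> I; rewrite /last_certificate; case: ifP => [_ ->|_ [t [eqt ->]]].
  exact: inv_last_qc I.
exact: inv_last_tc I _ eqt.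
Qed.

Lemma keeps_do_timeout F : keeps F (do_timeout S self).
Proof.
move=> e s s' o [I Fs] [[_ [c [lc]]]|[_ [-> ->]]]; last by exists e; split.
move=> [s1 [o1 [o2 [[-> ->] [s2 [o3 [o4 [[-> ->] [-> ->] ->]]]] ->]]]].
have kc := last_certificate_known I lc.
set v := cur_view s; set T := local_tip s.
exists (TimeoutVote v T (qc_view (last_qc s)) :: e); split.
- exact/List.incl_tl/List.incl_refl.
- split=> //; case: I => i1 i2 i3 i4 i5 i6 i7 i8 i9 i10 i11; split=> //=.
  + by rewrite /logged /= => n [<-|/i5].
  (* [highest_voted_view] becomes the current view, which bounds all events. *)
  + by move=> x [<-//|/i10].
  + by move=> x [<-//|/i10].
  + by move=> w T' [//|/i11 ?]; right.
move=> j m sg /In_map[k _ [_ ->]].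
have mv (h : hash) : h = block_hash (tip_header T) ->
    made (TimeoutVote v T (qc_view (last_qc s)) :: e) (vote_sig (make_vote S self v h)).
  by move=> ->; exists T => //; right; exists (qc_view (last_qc s)); left.
have mt tv qv : (if tip_view T <= qc_view (last_qc s) then tv = None /\ qv = qc_view (last_qc s)
    else tv = Some (tip_view T) /\ qv = qc_view (tip_qc T)) ->
    made (TimeoutVote v T (qc_view (last_qc s)) :: e) (Sig self (CTimeout hash v tv qv)).
  by move=> rep; exists T, (qc_view (last_qc s)); split=> //; left.
case: ifP => le_T /=; rewrite /sigs_of_timeout /= => /In_cat.
  case=> [/(inv_last_qc I)|/In_cat[/kc|[<-|//]]]; try by left.
  by right; split=> //; apply: mt; rewrite le_T.
case=> [/(inv_local_tip I)|[<-|/In_cat[/kc|[<-|//]]]]; try by left.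
  by right; split=> //; apply: mv.
by right; split=> //; apply: mt; rewrite le_T.
Qed.

(** Collected votes agree on the proposal id only; collision-freeness recovers the view and block
    hash, so all signatures are on the same content. *)
Lemma forms_qc_signed (note_of : vote f hash -> note f hash payload) e s vt q :
  (forall vt', justified_note (note_of vt') -> valid_vote S vt' /\ base (vote_sig vt')) ->
  inv e s -> valid_vote S vt -> forms_qc note_of vt s q ->
  signed_qc S q /\ sigs_known (qc_sigs q).
Proof.
move=> jn I [pid _] [eqv eqh eqp aq fq]; split.
  split=> // [|sg sgq]; first by rewrite eqp eqv eqh.
  have [vt' [/(inv_log I)/jn[[pid' sg'] _] eqp' <-]] := fq _ sgq.
  have [eqh' eqv'] : vote_hash vt' = vote_hash vt /\ vote_view vt' = vote_view vt.
    by apply: (proposal_id_inj (S := S)); rewrite -pid -pid'.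
  by rewrite sg' eqp eqv eqh eqp' eqh' eqv'.
by move=> sg /fq[vt' [/(inv_log I)/jn[_ bs] _ <-]].
Qed.

Lemma recorded_sigs e s v k Ms M :
  inv e s -> recorded_timeouts v k s Ms -> List.In M Ms -> sigs_known (sigs_of_timeout M).
Proof. by move=> I [_ _ rM] /rM[/(inv_log I)]. Qed.

Lemma sigs_of_reported_qc M :
  List.incl (qc_sigs (reported_qc S M)) (sigs_of_timeout M).
Proof.
rewrite /reported_qc /sigs_of_timeout; case: (tmo_tip M) => [T|].
  exact/List.incl_appl/sigs_of_tip_qc.
case: (tmo_qc M) => [q|] sg // sgq.
by do 2!(apply/In_cat; right); apply/In_cat; left.
Qed.

Lemma forms_tc_known e s v c : inv e s -> forms_tc S v s c -> sigs_known (sigs_of_tc c).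
Proof.
move=> I [Ms [rMs /=]]; have kM M := recorded_sigs I rMs (M := M).
have ks : sigs_known [seq tmo_sig M | M <- Ms].
  move=> sg /In_map[M /kM k ->]; apply: k.
  by rewrite /sigs_of_timeout; do 4!(apply/In_cat; right); left.
case: ifP => _ => [[T [-> [M [/kM k eqT]] _ _]]|[M [/kM k _ ->]]].
  apply/sigs_known_cat; split=> // sg sgT.
  by apply: k; rewrite /sigs_of_timeout eqT; apply/In_cat; left.
apply/sigs_known_cat; split=> //; apply/sigs_known_cat; split=> // sg sgq.
exact/k/sigs_of_reported_qc.
Qed.

(** * Preservation by the handlers *)

Lemma keeps_on_vote vt :
  base (vote_sig vt) -> keeps anyview (on_vote S self now sent vt).
Proof.
move=> kvt; apply: keeps_when => _ _ _ [vvt _ _].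
apply: keeps_seq; first exact: keeps_remember.
apply: keeps_ifsome => [e s q I fq|]; last exact: keeps_skip.
have [//|sq kq] := forms_qc_signed _ I vvt fq.
apply: keeps_seq; first exact: keeps_Enter.
apply: keeps_seq; first by apply: keeps_Commit; split=> //; left; right.
by apply: keeps_ifelse => *; [apply: keeps_BroadcastQC|apply: keeps_ProposeQC].
Qed.

Lemma keeps_on_qc j q : sigs_known (qc_sigs q) -> keeps anyview (on_qc S self now sent j q).
Proof.
move=> kq; apply: keeps_when => _ _ _ [vq _].
have cq : committable q by split=> //; left.
apply: keeps_seq.
  apply: keeps_when => _ _ _ _; apply: keeps_seq; first exact: keeps_Enter.
  apply: keeps_seq; first exact: keeps_Commit.
  by apply: keeps_send; apply: sendable_known.
apply: keeps_seq; first by apply: keeps_when => *; apply: keeps_BroadcastQC.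
apply: keeps_when => _ _ _ _; apply: keeps_seq; first exact: keeps_Enter.
by apply: keeps_seq; [apply: keeps_Commit|apply: keeps_ProposeQC].
Qed.

Lemma keeps_record_timeout M :
  sigs_known (sigs_of_timeout M) -> keeps anyview (record_timeout S self now M).
Proof.
move=> kM; apply: keeps_seq; first exact: keeps_remember.
apply: keeps_seq; first by apply: keeps_when => *; apply: keeps_do_timeout.
apply: keeps_ifsome => [e s c I /(forms_tc_known I) kc|]; last exact: keeps_skip.
apply: keeps_seq; first exact: keeps_Enter.
by apply: keeps_when => *; apply: keeps_ProposeTC.
Qed.

Lemma keeps_on_timeout M :
  sigs_known (sigs_of_timeout M) -> keeps anyview (on_timeout S self now sent M).
Proof.
move=> kM; apply: keeps_when => _ _ _ [[vc _ vM] _].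
have [_ /sigs_known_cat[kv /sigs_known_cat[_ /sigs_known_cat[kc _]]]] :=
  proj1 (sigs_known_cat _ _) kM.
apply: keeps_seq.
  by case: (tmo_last_cer M) kc => [q|c] kc; [apply: keeps_skip|apply: keeps_BroadcastTC].
apply: keeps_seq; first exact: keeps_Enter.
apply: keeps_seq; first by apply: keeps_when => *; apply: keeps_Propose.
apply: keeps_seq.
  case: (tmo_last_cer M) kc vc => [q|c] kq vq; last exact: keeps_skip.
  apply: keeps_seq; first by apply: keeps_when => *; apply: keeps_BroadcastQC.
  do 2!(apply: keeps_seq; first by apply: keeps_send; apply: sendable_known).
  by apply: keeps_Commit; split=> //; left.
case: (tmo_tip M) vM => [T|] vM; last exact: keeps_record_timeout.
case eqvt: (tmo_tip_vote M) => [vt|]; last exact: keeps_record_timeout.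
have vvt : valid_vote S vt.
  by case: (tmo_qc M) vM => // -[[vt' [eqvt' ? _]] _ _ _]; move: eqvt'; rewrite eqvt => -[->].
have kvt : base (vote_sig vt) by apply: kv; rewrite eqvt; left.
apply: keeps_seq; first exact: keeps_remember.
apply: keeps_ifsome => [e s q I fq|]; last exact: keeps_record_timeout.
have [//|sq kq] := forms_qc_signed _ I vvt fq.
apply: keeps_seq; first exact: keeps_Enter.
apply: keeps_seq; first by apply: keeps_Commit; split=> //; left; right.
by apply: keeps_when => *; apply: keeps_ProposeQC.
Qed.

Lemma keeps_on_tc c : sigs_known (sigs_of_tc c) -> keeps anyview (on_tc S self now c).
Proof.
move=> kc; apply: keeps_when => _ _ _ _; apply: keeps_seq; first exact: keeps_Enter.
by apply: keeps_seq; [apply: keeps_BroadcastTC|apply: keeps_when => *; apply: keeps_ProposeTC].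
Qed.

Lemma keeps_on_request j c (answer : tip f hash -> cmd) :
  sigs_known (sigs_of_tc c) ->
  (forall T, valid_tc S c -> high_tip c = Some T ->
     triple (inv_on (eq (tc_view c).+1)) (inv_on anyview) (answer T)) ->
  keeps anyview (on_request S now j c answer).
Proof.
move=> kc ka e s s' o [I _] [[_ [T [[_ le_s vc hT]]]]|[_ [-> ->]]]; last by exists e; split.
by apply: (triple_seq (triple_Enter (c := CertTC c) kc) (ka T vc hT)); split.
Qed.

Lemma keeps_anyview F (c : cmd) : keeps F c -> triple (inv_on F) (inv_on anyview) c.
Proof. by move=> kc e s s' o I r; have [e' [? [? _] ?]] := kc _ _ _ _ I r; exists e'; split. Qed.

Lemma keeps_on_proposal_request j c :
  sigs_known (sigs_of_tc c) -> keeps anyview (on_proposal_request S now j c).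
Proof.
move=> kc; apply: keeps_on_request => // T _ _; apply: keeps_anyview.
apply: keeps_ifsome => [e s p I [/(inv_log I) kp _]|]; last exact: keeps_skip.
by apply: keeps_send; apply: sendable_known.
Qed.

Lemma keeps_on_ne_request j c :
  sigs_known (sigs_of_tc c) -> (forall T, high_tip c = Some T -> known T) ->
  keeps anyview (on_ne_request S self now j c).
Proof.
move=> kc khT; apply: keeps_on_request => // T vc hT.
move=> e s s' o [I eqv] [[[nV _]]|[_ [-> ->]]]; last by exists e; split.
move=> [s1 [o1 [o2 [[-> ->] [-> ->] ->]]]].
exists (Refusal (tc_view c).+1 T :: e); split.
- exact/List.incl_tl/List.incl_refl.
- split=> //; case: (inv_add_note I (n := SentNE f hash payload (tc_view c).+1) Logic.I).
  move=> i1 i2 i3 i4 i5 i6 i7 i8 i9 i10 i11; split=> //.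
  + split=> // [x /i10|]; first by rewrite eqv.
    split; first by exists c; split=> //; apply: khT.
    (* Each proposal vote in the history left its id in the log, so the guard of the handler
       excludes all of them. *)
    by move=> w' T' inV eqT; apply: nV; rewrite eqT; apply: (inv_voted I).
  + by move=> x [<-//|/i9].
  + by move=> x [<-|/i10//]; rewrite /= eqv.
  + by move=> w T' [//|/i11].
move=> j' m sg [[_ <-]|//] [<-|//]; right; split=> //.
by exists T => //; left.
Qed.

Lemma keeps_on_ne sg : base sg -> keeps anyview (on_ne S self sg).
Proof.
move=> ksg; apply: keeps_ifsome => [e s rT I [inr hT _]|]; last exact: keeps_skip.
have kc := inv_recoveries I inr.
apply: keeps_seq; first exact: keeps_remember.
apply: keeps_ifsome => [e' s' ne I' [_ _ _ fe]|]; last exact: keeps_skip.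
apply: keeps_seq; first exact: keeps_finish_recovery.
apply: keeps_issue_new => [sg'|c [<-]//|ne' [<-] sg' /fe[/(inv_log I')//]].
by move/(sigs_of_tip_qc)/(sigs_of_high_tip hT)/kc.
Qed.

Lemma valid_proposal_committable p :
  valid_proposal S p -> sigs_known (sigs_of_tip (tip_of p)) -> committable (prop_qc p).
Proof.
move=> [[vh _] _ _ _ _] kp; split; last first.
  by move=> sg /(sigs_of_tip_qc (T := tip_of p))/kp.
by case: vh => [eqh|[]]; [right; rewrite /prop_qc eqh|left].
Qed.

(** For a reproposal the tip voted on is the high tip of the TC, while the proposal itself supplies
    the full block with the same header. *)
Lemma proposal_votable p T :
  valid_proposal S p -> known (tip_of p) -> sigs_known (sigs_of_tip (tip_of p)) ->
  (forall c T', prop_tc p = Some c -> high_tip c = Some T' -> known T') ->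
  voting_tip p T ->
  votable S base known (prop_view p) T /\ sigs_known (sigs_of_tip T).
Proof.
move=> [vB _ _ _ [frP refrP]] kp bp kn [[fp ->]|[nfp [c [tcp hT]]]].
  split=> //; split=> //; [exact: frP| |by left].
  by exists (prop_block p) => //; apply: valid_block_sound.
have [_ [c' [T' [tcp' vc eqv hT' eqh]]]] := refrP nfp.
move: tcp'; rewrite tcp => -[eqc]; subst c'; move: hT'; rewrite hT => -[eqT]; subst T'.
have bc : sigs_known (sigs_of_tc c).
  by move=> sg sgc; apply: bp; rewrite /= tcp; do 2!(apply/In_cat; right); apply/In_cat; left.
have [vT _ _] := valid_tc_high_tip vc hT.
split; last by move=> sg /(sigs_of_high_tip hT)/bc.
split=> //; first exact: kn tcp hT.
  by exists (prop_block p) => //; apply: valid_block_sound.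
by right; exists c; split=> //; apply: kn tcp hT.
Qed.

Lemma triple_vote p :
  (forall T, voting_tip p T ->
     votable S base known (prop_view p) T /\ sigs_known (sigs_of_tip T)) ->
  triple (inv_on (eq (prop_view p))) (inv_on anyview)
    (when (fun s => highest_voted_view s < prop_view p)
      (choosing (fun _ => voting_tip p) (fun T => reading (fun s =>
         let v := cur_view s in
         let vt := make_vote S self v (block_hash (tip_header T)) in
         andthen (update (set_local_tip T)) (
         andthen (send (MVote payload vt) (leader f v)) (
         andthen (send (MVote payload vt) (leader f v.+1)) (
         andthen (remember (Voted f payload (vote_pid vt)))
         (update (set_highest_voted v))))))))).
Proof.
move=> vP e s s' o [I eqv] [[lt_v [T [vT]]]|[_ [-> ->]]]; last by exists e; split.
have [voT kT] := vP T vT.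
move=> [s1 [o1 [o2 [[-> ->] [s2 [o3 [o4 [[-> ->] [s3 [o5 [o6 [[-> ->]
  [s4 [o7 [o8 [[-> ->] [-> ->] ->]]]] ->]]]] ->]]]] ->]]]].
exists (ProposalVote (cur_view s) T :: e); split.
- exact/List.incl_tl/List.incl_refl.
- split=> //; case: I => i1 i2 i3 i4 i5 i6 i7 i8 i9 i10 i11; split=> //=.
  + by rewrite /logged /= => n [<-|/i5].
  + split=> //; split; first by rewrite -eqv.
    by move=> x inx bx; rewrite -eqv; apply: leq_ltn_trans lt_v; apply: i9.
  + move=> x [<-//|inx bx]; apply: i10 inx.
  + by move=> x [<-//|/i10].
  + by rewrite /logged /= => w T' [[-> ->]|/i11 ?]; [left|right].
have mv : made (ProposalVote (cur_view s) T :: e)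
    (vote_sig (make_vote S self (cur_view s) (block_hash (tip_header T)))).
  by exists T => //; left; left.
by move=> j m sg /= [[_ <-]|[[_ <-]|//]] [<-|//]; right.
Qed.

Lemma keeps_on_leader_proposal p :
  valid_proposal S p -> known (tip_of p) -> sigs_known (sigs_of_tip (tip_of p)) ->
  (forall c T, prop_tc p = Some c -> high_tip c = Some T -> known T) ->
  triple (inv_on (fun v => v <= prop_view p)) (inv_on anyview)
    (on_leader_proposal S self now sent p).
Proof.
move=> vp kp bp kn; have cq := valid_proposal_committable vp bp; have [_ kq] := cq.
pose c := if prop_tc p is Some c then CertTC c else CertQC (prop_qc p).
have kc : cert_known c.
  rewrite /c /cert_known; case eqc: (prop_tc p) => [tc|//].
  by move=> sg sgc; apply: bp; rewrite /= eqc; do 2!(apply/In_cat; right); apply/In_cat; left.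
(* In every case of validity the certificate entered is of the preceding view, so the vote is cast
   in the view of the proposal. *)
have eqv : prop_view p = (cert_view c).+1.
  rewrite /c; case: (vp) => _ _ _ [_ lt_q] [frP refrP].
  case: (classic (fresh p)) => [/frP vT|/refrP[_ [c' [T [-> _ ->]]]]//].
  have [_ _ _ _] := valid_fresh_tipP vT (leq_ltn_trans (leq0n _) lt_q).
  by rewrite /=; case=> [[-> ->]|[c' [-> _ -> _]]].
apply: (triple_seq (M := inv_on (eq (prop_view p)))).
  by move=> e s s' o; rewrite eqv => I r; apply: (triple_Enter kc) r.
apply: (triple_seq (M := inv_on (eq (prop_view p)))).
  apply: keeps_when => *; apply: keeps_seq.
    by apply: keeps_when => *; apply: keeps_BroadcastQC.
  by apply: keeps_send; apply: sendable_known.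
apply: (triple_seq (M := inv_on (eq (prop_view p)))); first exact: keeps_Commit.
exact: triple_vote (fun T => proposal_votable vp kp bp kn).
Qed.

Lemma keeps_on_proposal j p :
  known (tip_of p) -> sigs_known (sigs_of_tip (tip_of p)) ->
  (forall c T, prop_tc p = Some c -> high_tip c = Some T -> known T) ->
  keeps anyview (on_proposal S self now sent j p).
Proof.
move=> kp bp kn; apply: keeps_when => _ _ _ vp.
apply: keeps_seq; first exact: keeps_remember.
apply: keeps_seq.
  move=> e s s' o [I _] [[[_ le_p] r]|[_ [-> ->]]]; last by exists e; split.
  exact: (keeps_on_leader_proposal vp kp bp kn) r.
apply: keeps_ifsome => [e s r I [inr _]|]; last exact: keeps_skip.
apply: keeps_seq; first exact: keeps_finish_recovery.
apply: keeps_issue => [sg sgq|c [<-]|//].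
  exact/bp/(sigs_of_tip_qc (T := tip_of p)).
exact: inv_recoveries I _ inr.
Qed.

Lemma keeps_handle j m :
  sigs_known (sigs_of m) -> (forall T, List.In T (tips_of m) -> known T) ->
  keeps anyview (handle S self now sent j m).
Proof.
case: m => [p|vt|q|M|c|c|c|sg] km kn /=.
- apply: keeps_on_proposal => //; first by apply: kn; left.
  move=> c T eqc hT; apply: kn => /=; right; rewrite eqc.
  by case: c hT {eqc} => v tv ht qv hq sg /= ->; case: T => *; left.
- by apply: keeps_on_vote; apply: km; left.
- exact: keeps_on_qc.
- exact: keeps_on_timeout.
- exact: keeps_on_tc.
- exact: keeps_on_proposal_request.
- apply: keeps_on_ne_request => // T hT; apply: kn.
  by case: c hT {km} => v tv ht qv hq sg /= ->; case: T => *; left.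
- by apply: keeps_on_ne; apply: km; left.
Qed.

Lemma keeps_timer_expires : keeps anyview (timer_expires S self now).
Proof. by move=> e s s' o I [_ r]; apply: keeps_do_timeout r. Qed.

Lemma keeps_recover_again : keeps anyview (recover_again S now).
Proof.
move=> e s s' o I [rs1 [r [rs2 [eqr _ run]]]].
have kr r' : List.In r' (rs1 ++ r :: rs2) -> sigs_known (sigs_of_tc (rec_tc r')).
  by rewrite -eqr; apply: inv_recoveries (proj1 I) _.
have kc : sigs_known (sigs_of_tc (rec_tc r)) by apply: kr; apply/In_cat; right; left.
apply: (keeps_ask_more kc _) I run => K; apply: keeps_recoveries => _ _ _ r'.
case/In_cat => [inr|[<-//|inr]]; apply: kr; apply/In_cat; first by left.
by right; right.
Qed.

End Invariant.

(** * Executions *)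

Section NestedTips.

Context (f : nat) (hash payload : Type).

Definition tips_closed (tips : seq (tip f hash)) (sigs : seq (signature f hash)) : Prop :=
  forall T, List.In T tips -> List.incl (sigs_of_tip T) sigs /\
    forall c T', tip_tc T = Some c -> high_tip c = Some T' -> List.In T' tips.

(** Mutual structural recursion along the nesting of tips in TCs and of TCs in tips. *)
Fixpoint tips_of_tip_closed (T : tip f hash) : tips_closed (tips_of_tip T) (sigs_of_tip T)
with tips_of_tc_closed (c : tc f hash) : tips_closed (tips_of_tc c) (sigs_of_tc c).
Proof.
- case: T => v pid hd sg otc onec T1.
  case: otc => [c|]; last by case=> [<-|[]]; split=> //.
  case=> [<-|inT].
    split=> // c' T2 [<-] hT2; right.
    by case: c hT2 => ? ? ? ? ? ? /= ->; case: T2 => *; left.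
  have [le_s cl] := tips_of_tc_closed c T1 inT.
  split=> [sg' /le_s ?|c' T2 eqc hT]; last by right; apply: cl eqc hT.
  by do 2!(apply/In_cat; right); apply/In_cat; left.
- case: c => v tv [T|] qv hq sg T1 inT; last by [].
  have [le_s cl] := tips_of_tip_closed T T1 inT.
  by split=> // sg' /le_s ?; apply/In_cat; left.
Qed.

Lemma tips_of_closed (m : msg f hash payload) : tips_closed (tips_of m) (sigs_of m).
Proof.
case: m => [p|vt|q|M|c|c|c|sg]; try exact: (@tips_of_tc_closed c); try by [].
  exact: (@tips_of_tip_closed (tip_of p)).
move=> T /In_cat[inT|inT].
  case eqT: (tmo_tip M) inT => [T0|//] inT.
  have [le_s cl] := tips_of_tip_closed inT.
  split=> [sg /le_s ?|c T' eqc hT].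
    by rewrite /= /sigs_of_timeout eqT; apply/In_cat; left.
  by rewrite /= eqT; apply/In_cat; left; apply: cl eqc hT.
case eqc: (tmo_last_cer M) inT => [//|c] inT.
have [le_s cl] := tips_of_tc_closed inT.
split=> [sg /le_s ?|c' T' eqc' hT].
  by rewrite /= /sigs_of_timeout eqc; do 3!(apply/In_cat; right); apply/In_cat; left.
by rewrite /= eqc; apply/In_cat; right; apply: cl eqc' hT.
Qed.

End NestedTips.

Section Execution.

Context (R : realFieldType) (f : nat) (hash payload : Type).
Context (S : setting R f hash payload).

Implicit Types (c : config R f hash payload) (T : tip f hash) (sg : signature f hash).

Definition base_in c sg : Prop :=
  exists e, List.In e (hist c) /\ List.In sg (sigs_of (body e)).

Definition known_in c T : Prop :=
  exists e, List.In e (hist c) /\ List.In T (tips_of (body e)).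

(** One ghost history per validator; nothing is asked of those of Byzantine validators. *)
Definition config_inv c : Prop :=
  (forall e, List.In e (net c) -> List.In e (hist c)) /\
  exists ev : validator f -> seq (event f hash),
    (forall i, correct S i -> inv S (base_in c) (known_in c) (ev i) (local c i)) /\
    (forall sg, base_in c sg -> correct S (signer sg) -> made (ev (signer sg)) sg).

Section Mono.

Context (base base' : signature f hash -> Prop) (known known' : tip f hash -> Prop).
Context (base_le : forall sg, base sg -> base' sg).
Context (known_le : forall T, known T -> known' T).

Lemma certified_mono (p : proposal f hash payload) q :
  certified S base known p q -> certified S base' known' p q.
Proof. by move=> [vp kp vq kq eqp]; split=> //; [apply: known_le|move=> sg /kq/base_le]. Qed.

Lemma justified_note_mono (n : note f hash payload) :
  justified_note S base known n -> justified_note S base' known' n.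
Proof.
case: n => //=.
- by move=> vt [? /base_le].
- by move=> vt [? /base_le].
- by move=> M k sg /k/base_le.
- by move=> p k sg /k/base_le.
- by move=> p [? [q /certified_mono ?]]; split=> //; exists q.
- by move=> B [p [q [gp [/certified_mono ? ? ? ?]]]]; exists p, q, gp.
Qed.

Lemma inv_mono e (s : state R f hash payload) :
  inv S base known e s -> inv S base' known' e s.
Proof.
case=> i1 i2 i3 i4 i5 i6 i7 i8 i9 i10 i11; split=> //.
- by move=> sg /i1/base_le.
- by move=> sg /i2/base_le.
- by move=> c /i3 k sg /k/base_le.
- by move=> r /i4 k sg /k/base_le.
- by move=> n /i5/justified_note_mono.
- exact: lawful_mono base_le known_le i6.
Qed.

End Mono.

Definition hist_le c c' : Prop := forall e, List.In e (hist c) -> List.In e (hist c').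

Lemma base_in_le c c' sg : hist_le c c' -> base_in c sg -> base_in c' sg.
Proof. by move=> le_c [e [/le_c ? ?]]; exists e. Qed.

Lemma known_in_le c c' T : hist_le c c' -> known_in c T -> known_in c' T.
Proof. by move=> le_c [e [/le_c ? ?]]; exists e. Qed.

Lemma step_hist_le c c' : step S c c' -> hist_le c c'.
Proof.
case.
- by move=> d _ ->.
- by move=> ? ? ? _ _ [? [? [_ ->]]] e ?; apply/In_cat; left.
- by move=> ? _ [? [? [_ ->]]] e ?; apply/In_cat; left.
- by move=> ? _ [? [? [_ ->]]] e ?; apply/In_cat; left.
- by move=> i j m _ _ -> e ? /=; rewrite -cats1; apply/In_cat; left.
Qed.

Lemma In_envelopes t i o e :
  List.In e (@envelopes R f hash payload t i o) ->
  exists2 j, List.In (j, body e) o & src e = i.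
Proof. by move=> /In_map[[j m] ? ->]; exists j. Qed.

Lemma executes_inv c c' i (a : cmd R f hash payload) net0 :
  config_inv c -> correct S i -> (forall e, List.In e net0 -> List.In e (net c)) ->
  keeps S i (base_in c) (known_in c) anyview a ->
  executes i a net0 c c' -> config_inv c'.
Proof.
move=> [net_le [ev [I made_ev]]] ci net0_le ka [s' [o [run ->]]].
have [e' [le_e [I' _] oo]] := ka _ _ _ _ (conj (I i ci) Logic.I) run.
set d := Config _ _ _ _; have le_c : hist_le c d by move=> e ?; apply/In_cat; left.
have ble sg : base_in c sg -> base_in d sg by apply: base_in_le.
have kle T : known_in c T -> known_in d T by apply: known_in_le.
split.
  by move=> e /In_cat[/net0_le/net_le|] ?; apply/In_cat; [left|right].
exists (fun j => if j == i then e' else ev j); split.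
  move=> j cj /=; case: eqP => _; first exact: (inv_mono ble kle I').
  exact: (inv_mono ble kle (I j cj)).
have le_ev sg : made (ev (signer sg)) sg ->
    made (if signer sg == i then e' else ev (signer sg)) sg.
  by case: eqP => // ->; apply: made_incl.
move=> sg [e [/In_cat[ine|ine] insg]] csg.
  by apply: le_ev; apply: made_ev csg; exists e.
have [j inj _] := In_envelopes ine.
case: (oo _ _ _ inj insg) => [bsg|[-> msg]]; first by apply/le_ev/made_ev.
by rewrite eqxx.
Qed.

Lemma sent_known_in c p :
  sent c p -> known_in c (tip_of p) /\ sigs_known (base_in c) (sigs_of_tip (tip_of p)).
Proof.
move=> [e [ine eqe]]; split; first by exists e; rewrite eqe; split=> //; left.
by move=> sg insg; exists e; rewrite eqe.
Qed.

Lemma step_inv c c' : config_inv c -> step S c c' -> config_inv c'.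
Proof.
move=> Jc; have [net_le _] := Jc; case.
- by move=> d _ ->.
- move=> es1 es2 e eqnet ce; apply: executes_inv => //.
    by move=> e' /In_cat ine; rewrite eqnet; apply/In_cat; case: ine; [left|right; right].
  have ine : List.In e (hist c) by apply: net_le; rewrite eqnet; apply/In_cat; right; left.
  apply: keeps_handle => [p|sg insg|T inT]; first exact: sent_known_in.
    by exists e.
  by exists e.
- by move=> i ci; apply: executes_inv => //; apply: keeps_timer_expires.
- by move=> i ci; apply: executes_inv => //; apply: keeps_recover_again.
move=> i j m nci auth ->; case: Jc => _ [ev [I made_ev]].
set d := Config _ _ _ _.
have le_c : hist_le c d by move=> e ? /=; rewrite -cats1; apply/In_cat; left.
split=> [e|] /=.
  by rewrite -!cats1 => /In_cat[/net_le|] ?; apply/In_cat; [left|right].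
exists ev; split.
  move=> k ck; apply: inv_mono (I k ck); first by move=> sg; apply: base_in_le.
  by move=> T; apply: known_in_le.
move=> sg [e [/=]]; rewrite -cats1 => /In_cat[ine|[<-|//]] insg csg.
  by apply: made_ev csg; exists e.
(* The adversary can only replay signatures of correct validators, and these occurred in an earlier
   message. *)
have [e' [ine' _ insg']] := auth _ insg csg.
by apply: made_ev csg; exists e'.
Qed.

Lemma start_inv i s o :
  start S i 0%R (init_state S) s o ->
  exists e, inv S (fun=> False) (fun=> False) e s /\
    out_ok i (fun=> False) e o.
Proof.
move=> [s1 [o1 [o2 [[[_ [eqs1 ->]]|[] //] run ->]]]].
(* The invariant starts after [Enter]: [init_state] has view 0, whereas [inv] requires a positive
   one. *)
have I1 : inv S (fun=> False) (fun=> False) [::] s1.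
  by rewrite eqs1; split=> //= sg; case: (genesis_hqc S) => _ ->.
have kw : keeps S i (fun=> False) (fun=> False) anyview
    (when (fun=> leads i 1) (ProposeQC S i (genesis_qc S))).
  by apply: keeps_when => *; apply: keeps_ProposeQC.
have [e [_ [I _] oo]] := kw _ _ _ _ (conj I1 Logic.I) run.
by exists e.
Qed.

Lemma initial_inv c : initial S c -> config_inv c.
Proof.
move=> [_ [outs [starts outs0 eqnet eqhist]]].
have /fin_all_exists[ev evP] : forall i : 'I_(3 * f).+1, exists e, correct S i ->
    inv S (fun=> False) (fun=> False) e (local c i) /\ out_ok i (fun=> False) e (outs i).
  move=> i; case: (boolP (i \in byz S)) => bi.
    by exists [::] => ci; rewrite /correct bi in ci.
  by have [e eP] := start_inv (starts i bi); exists e.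
split; first by rewrite eqhist.
exists ev; split.
  by move=> i ci; have [I _] := evP i ci; apply: inv_mono I.
move=> sg [e [ine insg]] csg.
have [i ini] : exists i, List.In e (envelopes 0%R i (outs i)).
  move: ine; rewrite eqhist eqnet; elim: (enum _) => //= i l IHl /In_cat[|/IHl //].
  by exists i.
have [j inj eqi] := In_envelopes ini.
have ci : correct S i.
  by apply/negP => bi; move: inj; rewrite outs0 // => /negP.
have [_ oo] := evP i ci.
by case: (oo _ _ _ inj insg) => // -[-> ].
Qed.

Lemma config_inv_snapshot c :
  config_inv c -> exists ev, snapshot S (base_in c) (known_in c) ev.
Proof.
move=> [_ [ev [I made_ev]]]; exists ev; split=> //.
- by move=> i ci; apply: inv_lawful (I i ci).
- move=> T sg [e [ine inT]] insg; exists e; split=> //.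
  by have [le_s _] := tips_of_closed inT; apply: le_s.
move=> T c0 [e [ine inT]] eqc; have [le_s cl] := tips_of_closed inT.
split=> [sg insg|T' hT]; last by exists e; split=> //; apply: cl eqc hT.
exists e; split=> //; apply: le_s.
by case: T eqc {cl inT} => ? ? ? ? ? ? /= ->; do 2!(apply/In_cat; right); apply/In_cat; left.
Qed.

Lemma execution_inv GST C k : execution S GST C -> config_inv (C k).
Proof.
move=> HC; elim: k => [|k IHk]; first exact: initial_inv (exec_initial HC).
exact: step_inv IHk (exec_step HC k).
Qed.

Lemma execution_hist_le GST C k k' : execution S GST C -> k <= k' -> hist_le (C k) (C k').
Proof.
move=> HC; elim: k' => [|k' IHk']; first by rewrite leqn0 => /eqP ->.
rewrite leq_eqVlt => /orP[/eqP -> //|le_k] e /(IHk' le_k).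
exact: (step_hist_le (exec_step HC k')).
Qed.

(** Allows log entries made at different times by different validators to be compared in one
    configuration. *)
Lemma execution_note GST C k k' i n :
  execution S GST C -> k <= k' -> correct S i -> logged n (local (C k) i) ->
  justified_note S (base_in (C k')) (known_in (C k')) n.
Proof.
move=> HC le_k ci logn; have le_c := execution_hist_le HC le_k.
have [_ [ev [I _]]] := execution_inv k HC.
apply: justified_note_mono (inv_log (I i ci) logn) => [sg|T].
  exact: base_in_le.
exact: known_in_le.
Qed.

(** * Safety of the commit rule and of speculative commits *)

Section Certified.

Context (base : signature f hash -> Prop) (known : tip f hash -> Prop).
Context (ev : validator f -> seq (event f hash)).
Context (snap : snapshot S base known ev).

Lemma certified_fresh (p : proposal f hash payload) q :
  certified S base known p q -> fresh p ->
  [/\ signed_qc S q, qc_view q = prop_view p & qc_hash q = block_hash (prop_block p)] /\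
  [/\ sound_block S (prop_block p), valid_fresh_tip S (tip_of p)
    & block_view (prop_block p) = prop_view p].
Proof.
move=> [[vB pid _ [_ lt_q] [frP _]] kp vq kq eqp] /frP vT; split; last first.
  by split=> //; [apply: valid_block_sound|apply: (valid_fresh_tip_block_view vT)].
case: vq => [eqq|sq].
  move: eqp; rewrite eqq pid /= /genesis_pid => /(proposal_id_inj (S := S))[_ eq0].
  by rewrite -eq0 in lt_q.
have [pidq _ _] := sq; move: eqp; rewrite pid pidq => /(proposal_id_inj (S := S))[-> ->].
by split.
Qed.

(** The block of [p] cannot be genesis, since the placeholder QC of genesis points to no
    proposal. *)
Lemma certified_parent_qc p q gp :
  certified S base known p q -> points_to S (prop_qc p) gp ->
  [/\ valid_qc S (prop_qc p), known_qc base (prop_qc p)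
    & qc_hash (prop_qc p) = block_hash (prop_block gp)].
Proof.
move=> [[[vh _] _ _ _ _] kp _ _ _] [[pidg _ _] eqg].
have vq : valid_qc S (prop_qc p).
  case: vh => [eqh|[]//].
  have := @genesis_no_parent _ _ _ _ S (block_hash (prop_block gp)) (prop_view gp).
  by case; rewrite -pidg eqg /prop_qc eqh.
split=> //; first exact: (known_tip_qc snap kp).
by case: vq (eqg) => [->|[-> _ _]]; rewrite pidg ?/genesis_pid => /(proposal_id_inj (S := S))[].
Qed.

Lemma commit_safety p q gp q' B :
  certified S base known p q -> qc_view q = (qc_view (prop_qc p)).+1 ->
  points_to S (prop_qc p) gp ->
  valid_qc S q' -> known_qc base q' -> qc_view (prop_qc p) <= qc_view q' ->
  sound_block S B -> block_hash B = qc_hash q' -> extends S B (prop_block gp).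
Proof.
move=> cp eqv pt vq' kq' le_q sB eqB.
have [[_ pid _ [_ lt_v] _] kp vq kq eqp] := cp.
(* [q] has the view of [p], and the commit rule puts the QC inside [p] one view earlier. *)
have fp : fresh p.
  constructor 1; rewrite -eqv; case: vq => [eqq|[pidq _ _]].
    by rewrite eqq in eqv.
  by move: eqp; rewrite pid pidq => /(proposal_id_inj (S := S))[].
have [[sq qv qh] [sP vT bv]] := certified_fresh cp fp.
have [[pidg hg xg] eqg] := pt.
have [vq1 kq1 hq1] := certified_parent_qc cp pt.
(* Here [u] is the view of [p], [t] is [u - 1] and [X] is the grandparent block. [D] is just the
   bound [t] on the QC view, which the tie-breaking rule preserves. *)
apply: (later_certified_extends snap sq kq qv qh sP bv (t := qc_view (prop_qc p))
  (D := fun T => qc_view (prop_qc p) <= qc_view (tip_qc T))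
  _ _ _ _ _ _ _ _ vq' kq' le_q sB eqB) => //.
- exact: ltnW.
- by move=> T eqT; rewrite /tip_qc eqT.
- by move=> T T' _ _ _ /leq_trans; apply.
- by right.
- apply: Relation_Operators.rt_step; exists gp; split=> //.
(* Only the view [t] remains in the range, and its certified hash is unique. *)
move=> q'' vq'' kq''; rewrite -qv eqv ltnS -eqn_leq => /eqP eqv'.
by rewrite -(certified_hash_unique snap kq1 vq1 kq'' vq'' eqv').
Qed.

Lemma speculative_safety p q q' B :
  certified S base known p q -> fresh p ->
  (forall T, known T -> valid_fresh_tip S T -> tip_view T = prop_view p ->
    tip_pid T = prop_pid p) ->
  valid_qc S q' -> known_qc base q' -> prop_view p <= qc_view q' ->
  sound_block S B -> block_hash B = qc_hash q' -> extends S B (prop_block p).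
Proof.
move=> cp fp uniq_p vq' kq' le_q sB eqB.
have [[sq qv qh] [sP vT bv]] := certified_fresh cp fp.
have [[_ pid _ [_ lt_v] _] kp vq kq eqp] := cp.
have same T : known T -> valid_fresh_tip S T -> tip_view T = prop_view p ->
    tip_header T = bheader (prop_block p).
  move=> kT fT eqT; have T_gt0 : 0 < tip_view T by rewrite eqT (leq_ltn_trans _ lt_v).
  have [/valid_header_hash hT pidT _ _ _] := valid_fresh_tipP fT T_gt0.
  apply: (header_inj hT (proj1 sP)).
  by move: (uniq_p T kT fT eqT); rewrite pidT pid => /(proposal_id_inj (S := S))[].
(* Here [t = u] and [X] is the block itself. [D] says that the header is that of [p]; without
   equivocation it holds for every tip of view [u], so none can be refused by a voter of [p]. *)
apply: (later_certified_extends snap sq kq qv qh sP bv (t := prop_view p)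
  (D := fun T => tip_header T = bheader (prop_block p))
  _ _ _ _ _ _ _ _ vq' kq' le_q sB eqB) => //.
- by move=> T T' kT' fT' eqT' _ _; apply: same.
- by move=> T kT fT eqT _ []; rewrite (uniq_p T kT fT eqT) pid.
- by left.
- exact: Relation_Operators.rt_refl.
by move=> q'' _ _ /andP[/leq_ltn_trans le_v /le_v]; rewrite ltnn.
Qed.

End Certified.

End Execution.

Theorem corollary1 (R : realFieldType) (f : nat) (hash payload : Type)
    (S : setting R f hash payload) (GST : R)
    (C : nat -> config R f hash payload) (HC : execution S GST C)
    (p : proposal f hash payload) (B B' : block f hash payload)
    (Hfresh : fresh_proposal p) (HB : speculatively_finalized S C p B)
    (HB' : committed S C B')
    (HBB' : ~ extends S B B') (HB'B : ~ extends S B' B) :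
  leader_equivocated S C (prop_view p).
Proof.
case: HB => i [k [ci logp eqB]]; case: HB' => j [k' [G [cj logG GB']]].
(* Both log entries are read in the later of the two configurations. *)
pose K := maxn k k'.
have /= [fp [q cp]] := execution_note HC (leq_maxl k k') ci logp.
have /= [par [q' [gp [cpar eqv pt eqG]]]] := execution_note HC (leq_maxr k k') cj logG.
rewrite -/K in cp cpar.
have [ev snap] := config_inv_snapshot (execution_inv K HC).
have [[sq qv qh] [sB vT bv]] := certified_fresh cp fp.
have [_ kp _ kq _] := cp.
apply: NNPP => no_equiv.
have issued_known T :
    known_in (C K) T -> valid_fresh_tip S T -> tip_view T = prop_view p -> issued S C T.
  move=> [e [ine inT]] fT eqT.
  have T_gt0 : 0 < tip_view T by rewrite eqT -qv; apply: (signed_qc_gt0 snap kq sq).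
  have [_ pidT sgT _ _] := valid_fresh_tipP fT T_gt0.
  by split=> //; exists K, e.
have uniq_p T : known_in (C K) T -> valid_fresh_tip S T -> tip_view T = prop_view p ->
    tip_pid T = prop_pid p.
  move=> kT fT eqT; apply: NNPP => ne_pid; apply: no_equiv.
  exists T, (tip_of p); split=> //; first exact: issued_known.
  exact: issued_known.
rewrite -eqG in GB'.
(* In the first case the QC of [p] is late enough for [B] to extend the committed block, hence [B'].
   In the second the committed block is certified after [p] and extends [B], so [B] and [B'] are
   both its ancestors. *)
case: (leqP (qc_view (prop_qc par)) (prop_view p)) => [le_v|lt_v].
  apply: HBB'; apply: Relation_Operators.rt_trans GB' _.
  rewrite -eqB; apply: (commit_safety snap cpar eqv pt _ kq) => //; first by right.
  by rewrite qv.
have [vq1 kq1 hq1] := certified_parent_qc snap cpar pt.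
have [[_ hg xg] _] := pt.
have GB : extends S (prop_block gp) B.
  by rewrite -eqB; apply: (speculative_safety snap cp fp uniq_p vq1 kq1 (ltnW lt_v)).
by case: (ancestors_comparable GB GB').
Qed.
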